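(* There exists a polynomial-time algorithm which solves the black-and-white coloring problem on strongly chordal graphs; that is, given a strongly chordal graph $G$ and integers $b$ and $w$, the algorithm decides in time polynomial in the number of vertices of $G$ whether $G$ has a black-and-white coloring with $b$ black vertices and $w$ white vertices.
   Context: Graphs are finite, simple and undirected. A black-and-white coloring of a graph $G=(V,E)$ with $b$ black and $w$ white vertices is a pair of disjoint sets $B,W\subseteq V$ (the black and the white vertices) with $|B|=b$ and $|W|=w$ such that no vertex of $B$ is adjacent to any vertex of $W$; the vertices outside $B\cup W$ are uncolored. The black-and-white coloring problem takes as input a graph $G$ and integers $b$ and $w$ and asks whether such a coloring exists. A graph is chordal if it has no induced cycle of length more than three. If $C=[x_1,\ldots,x_{2k}]$ is a cycle of even length, a chord $(x_i,x_j)$ of $C$ is an odd chord if the distance in $C$ between $x_i$ and $x_j$ is odd. A graph $G$ is strongly chordal if $G$ is chordal and each cycle in $G$ of even length at least six has an odd chord. *)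

(* Defs.v *)
From mathcomp Require Import all_boot all_order all_algebra.

Set Implicit Arguments.
Unset Strict Implicit.
Unset Printing Implicit Defensive.

Definition simple_graph (T : finType) (e : rel T) : Prop :=
  symmetric e /\ irreflexive e.

Definition graph_cycle (T : finType) (e : rel T) (c : seq T) : Prop :=
  2 < size c /\ ucycle e c.

(* One of the two truncated differences is zero, so [d] is the absolute
   difference of the positions of [x] and [y] in [c]. *)
Definition cycle_dist (T : finType) (c : seq T) (x y : T) : nat :=
  let d := (index x c - index y c) + (index y c - index x c) in
  minn d (size c - d).

Definition induced_cycle (T : finType) (e : rel T) (c : seq T) : Prop :=
  graph_cycle e c /\ {in c &, forall x y, e x y = (cycle_dist c x y == 1)}.

Definition chordal (T : finType) (e : rel T) : Prop :=
  ~ exists2 c : seq T, induced_cycle e c & 3 < size c.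

Definition chord (T : finType) (e : rel T) (c : seq T) (x y : T) : Prop :=
  [/\ x \in c, y \in c, e x y & cycle_dist c x y != 1].

Definition odd_chord (T : finType) (e : rel T) (c : seq T) (x y : T) : Prop :=
  chord e c x y /\ odd (cycle_dist c x y).

Definition strongly_chordal (T : finType) (e : rel T) : Prop :=
  chordal e /\
  forall c : seq T, graph_cycle e c -> ~~ odd (size c) -> 6 <= size c ->
    exists x y : T, odd_chord e c x y.

Definition bw_coloring (T : finType) (e : rel T) (B W : {set T}) : bool :=
  [disjoint B & W] && [forall x in B, forall y in W, ~~ e x y].

Definition bw_colorable (T : finType) (e : rel T) (b w : nat) : bool :=
  [exists B : {set T}, exists W : {set T},
    [&& bw_coloring e B W, #|B| == b & #|W| == w]].

(** Random access machine: structured programs over registers and unbounded arrays of natural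
    numbers.  Registers and arrays have fixed names, so a program uses finitely
    many of each; array cells are addressed by computed indices.  Every
    operation has unit cost.  The only arithmetic is addition and truncated
    subtraction: a number computed in [t] steps from inputs of [l] bits has
    [O(t + l)] bits, hence unit-cost time is polynomially related to
    logarithmic-cost time and to Turing machine time.  Unit-cost multiplication
    would break this and is deliberately absent. *)

Inductive expr : Type :=
| Const of nat
| Reg of nat
| Read of nat & expr            (* array name, index *)
| Add of expr & expr
| Sub of expr & expr.

Inductive cmd : Type :=
| Skip
| Assign of nat & expr
| Write of nat & expr & expr    (* array name, index, value *)
| Seq of cmd & cmd
| If of expr & cmd & cmd        (* a test succeeds when it is nonzero *)
| While of expr & cmd.

Record state : Type := State { reg : nat -> nat; arr : nat -> nat -> nat }.

Definition set_reg (s : state) (x v : nat) : state :=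
  State (fun y => if y == x then v else reg s y) (arr s).

Definition set_arr (s : state) (a i v : nat) : state :=
  State (reg s)
    (fun a' i' => if (a' == a) && (i' == i) then v else arr s a' i').

Fixpoint eval (s : state) (f : expr) : nat :=
  match f with
  | Const k => k
  | Reg x => reg s x
  | Read a f1 => arr s a (eval s f1)
  | Add f1 f2 => eval s f1 + eval s f2
  | Sub f1 f2 => eval s f1 - eval s f2
  end.

Fixpoint expr_cost (f : expr) : nat :=
  match f with
  | Const _ | Reg _ => 1
  | Read _ f1 => (expr_cost f1).+1
  | Add f1 f2 | Sub f1 f2 => (expr_cost f1 + expr_cost f2).+1
  end.

(* [exec c s t s']: started in [s], [c] halts in state [s'] after time [t].  A
   diverging run has no derivation. *)
Inductive exec : cmd -> state -> nat -> state -> Prop :=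
| ExecSkip s :
    exec Skip s 1 s
| ExecAssign s x f :
    exec (Assign x f) s (expr_cost f).+1 (set_reg s x (eval s f))
| ExecWrite s a f g :
    exec (Write a f g) s (expr_cost f + expr_cost g).+1
      (set_arr s a (eval s f) (eval s g))
| ExecSeq s1 s2 s3 c1 c2 t1 t2 :
    exec c1 s1 t1 s2 -> exec c2 s2 t2 s3 ->
    exec (Seq c1 c2) s1 (t1 + t2) s3
| ExecIfTrue s s' f c1 c2 t :
    eval s f != 0 -> exec c1 s t s' ->
    exec (If f c1 c2) s (expr_cost f + t).+1 s'
| ExecIfFalse s s' f c1 c2 t :
    eval s f == 0 -> exec c2 s t s' ->
    exec (If f c1 c2) s (expr_cost f + t).+1 s'
| ExecWhileTrue s1 s2 s3 f c t1 t2 :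
    eval s1 f != 0 -> exec c s1 t1 s2 -> exec (While f c) s2 t2 s3 ->
    exec (While f c) s1 (expr_cost f + t1 + t2).+1 s3
| ExecWhileFalse s f c :
    eval s f == 0 ->
    exec (While f c) s (expr_cost f).+1 s.

(* Registers 0, 1, 2 hold [n], [b], [w]; array 0 holds the adjacency matrix in
   row-major order; everything else is zero. *)
Definition bw_input (n : nat) (e : rel 'I_n) (b w : nat) : state :=
  State (fun x => nth 0 [:: n; b; w] x)
    (fun a k => (a == 0) && [exists i : 'I_n, exists j : 'I_n,
                               (k == i * n + j) && e i j]).

Definition output (s : state) : nat := reg s 0.

(* Main.v *)
Require Import Defs.
From mathcomp Require Import all_boot all_order all_algebra.
From mathcomp Require Import all_fingroup zify.

Set Implicit Arguments.
Unset Strict Implicit.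
Unset Printing Implicit Defensive.

(** Coloring [b] vertices black and [w] vertices white amounts to finding a
    [b] by [w] zero block in the closed neighborhood matrix.  For a strongly
    chordal graph this matrix has no chordless cycle, so its rows and columns
    can be ordered without a configuration 1 1 / 1 0: in a doubly lexical
    ordering such a configuration would extend to a chordless cycle (Lubiw).
    The existence of one such ordering makes a greedy construction of another
    succeed: the next column is one whose rows form a chain on the remaining
    columns, the next row is one that creates no bad configuration.

    In the sorted matrix the columns are decided from the last to the first;
    making a column white excludes its rows from being black.  Link two rows if
    they share a column before [x].  Each connected component of the rows that
    are still allowed consists of all the rows below its largest row [f] in a
    forest that depends on [x] only, so it is determined by [x] and [f].  A
    dynamic program over the pairs [(x, f)], which convolves the components one
    after the other, therefore runs in polynomial time. *)

(** * Chordless cycles *)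

(** The diagonal of the closed neighborhood matrix consists of ones, so a zero block is both free of
    edges and disjoint in its two sides. Rows and columns carry different colors and may be permuted
    independently.

    The exponential weights behind a doubly lexical ordering serve only to prove that it exists. The
    ordering that the machine builds has to come from tests with a fixed number of quantifiers over
    indices, and this is what the greedy construction supplies.

    The obstacle for the dynamic program is that the allowed rows depend on all earlier choices.
    Sorting removes it in two ways. If two rows share columns with a common lower row, they share
    one with each other, so descents form a forest. And a row inherits from the rows below it every
    column from [x] on, so a white column excludes a set of rows closed upward, and what remains is
    a union of full descents.

    The program is generated from terms whose only loop is a bounded sum: sums of truth values
    express quantifiers, minima and cardinalities, and sums of equal summands replace
    multiplication. *)

Lemma shortest_path (T : finType) (f : rel T) (p q : T) :
  connect f p q -> exists l, [/\ path f p l, last p l = q, uniq (p :: l) &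
    forall i j, i.+1 < j -> j < (size l).+1 ->
      ~~ f (nth p (p :: l) i) (nth p (p :: l) j)].
Proof.
move=> /connectP[l0 pl0 ql0].
have exP : exists k, [exists l : k.-tuple T, path f p l && (last p l == q)].
  by exists (size l0); apply/existsP; exists (in_tuple l0); rewrite pl0 ql0 /=.
case: (ex_minnP exP) => k /existsP[l /andP[pl /eqP ql]] kmin.
have {kmin} lmin l' : path f p l' -> last p l' = q -> size l <= size l'.
  move=> pl' ql'; rewrite size_tuple; apply: kmin; apply/existsP.
  by exists (in_tuple l'); rewrite /= pl' ql' eqxx.
move: (tval l) pl ql lmin => {k}l pl ql lmin.
exists l; split=> //.
  case/shortenP: (pl) (ql) => l' pl' ul' sl' ql'.
  have subl : {subset p :: l' <= p :: l}.
    by move=> x; rewrite !inE => /orP[-> // | /sl' ->]; rewrite orbT.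
  by apply: (leq_size_uniq ul' subl); rewrite /= ltnS lmin.
move=> i [//|j] ltij ltj /=; apply/negP => fij.
have szl : j < size l by [].
(* Shortcut over the arc from position [i] to position [j.+1] of [p :: l]; the latter is position
   [j] of [l]. *)
pose l' := take i l ++ drop j l.
have szl' : size l' < size l by rewrite size_cat size_take size_drop; case: ifP; lia.
have pnth : last p (take i l) = nth p (p :: l) i.
  rewrite (last_nth p) size_takel; last by lia.
  by case: i {fij l' szl'} ltij => //= i ltij; rewrite nth_take.
have pl' : path f p l'.
  rewrite cat_path; apply/andP; split.
    by move: pl; rewrite -{1}(cat_take_drop i l) cat_path => /andP[].
  rewrite (drop_nth p) //= pnth fij /=.
  by move: pl; rewrite -{1}(cat_take_drop j l) cat_path (drop_nth p szl) /= => /and3P[].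
have := lmin _ pl'; rewrite leqNgt szl' => /(_ _) abs.
suff : false by []; apply: abs; rewrite -ql -[in RHS](cat_take_drop j l) /l' !last_cat.
by rewrite (drop_nth p szl).
Qed.

Lemma mem_path (T : finType) (f : rel T) (A : pred T) (p : T) (l : seq T) :
  (forall x y, f x y -> A y) -> path f p l -> all A l.
Proof.
move=> fA; elim: l p => //= y l IHl p /andP[fpy pl].
by rewrite (fA _ _ fpy) (IHl y).
Qed.

(** Cycle distances in [v :: p :: l] with [s = size l]: [v] has position 0 and entry [i] of [p :: l]
    has position [i.+1], so the ends of the path are the entries 0 and [s]. *)
Lemma cycle_gap0 s i : 1 < s -> i < s.+1 ->
  (minn (0 - i.+1 + (i.+1 - 0)) (s.+2 - (0 - i.+1 + (i.+1 - 0))) == 1)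
  = (i == 0) || (i == s).
Proof. lia. Qed.

Lemma cycle_gap s i j : i < s.+1 -> j < s.+1 ->
  (minn (i.+1 - j.+1 + (j.+1 - i.+1)) (s.+2 - (i.+1 - j.+1 + (j.+1 - i.+1))) == 1)
  = (i - j + (j - i) == 1).
Proof. lia. Qed.

(* A shortest detour around [v] closes up through [v] to an induced cycle. *)
Lemma chordal_no_detour (T : finType) (e : rel T) (v p q : T) (S : pred T) :
  symmetric e -> irreflexive e -> chordal e ->
  e v p -> e v q -> p != q -> ~~ e p q ->
  ~~ S v -> S p -> {in S, forall u, e v u -> u = p \/ u = q} ->
  ~~ connect (fun x y => S y && e x y) p q.
Proof.
move=> esym eirr che evp evq npq nepq Sv Sp Sn.
set f := (fun x y => _); apply/negP => /shortest_path[l [pl ql ul indl]].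
have Sl : all S l by apply: (@mem_path _ f) pl => x y /andP[].
have Sall : all S (p :: l) by rewrite /= Sp.
have el : path e p l by apply: sub_path pl => x y /andP[].
(* Since [p] and [q] are distinct and not adjacent, the path has an inner vertex, and with [v] the
   cycle has length at least four. *)
apply: che; exists (v :: p :: l); last first.
  case: l ql {indl pl ul Sl Sall} el => [/eqP|y [ /= ->|//]]; first by rewrite (negPf npq).
  by rewrite (negPf nepq).
have szl : 1 < size l.
  case: l ql {indl pl ul Sl Sall} el => [/eqP|y [ /= ->|//]]; first by rewrite (negPf npq).
  by rewrite (negPf nepq).
have nv : v \notin p :: l by apply/negP => /(allP Sall); apply/negP.
have uc : uniq (v :: p :: l) by rewrite cons_uniq nv.
have idxv : index v (v :: p :: l) = 0 by rewrite /= eqxx.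
have idx y : v != y -> index y (v :: p :: l) = (index y (p :: l)).+1.
  by move=> /negPf nvy; rewrite [LHS]/= nvy.
have ecv y : y \in p :: l -> e v y = (cycle_dist (v :: p :: l) v y == 1).
  move=> yl; have nvy : v != y by apply: contraNneq nv => ->.
  rewrite /cycle_dist idxv (idx _ nvy) [size _]/=.
  have [i ltil [yE ->]] : exists2 i, i < (size l).+1 &
      nth p (p :: l) i = y /\ index y (p :: l) = i.
    exists (index y (p :: l)); last by rewrite nth_index.
    by rewrite -[(size l).+1]/(size (p :: l)) index_mem.
  have lastE : nth p (p :: l) (size l) = q by rewrite -last_nth.
  have Sy := allP Sall y yl.
  rewrite cycle_gap0 //; apply/idP/orP => [evy | [] /eqP iE].
  - case: (Sn _ Sy evy) => ye; first by left; rewrite -(nth_uniq p _ _ ul) // yE ye.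
    by right; rewrite -(nth_uniq p _ _ ul) // yE lastE ye.
  - by rewrite -yE iE.
  - by rewrite -yE iE lastE.
split; first split.
- by rewrite /= !ltnS ltnW.
- by rewrite /ucycle uc andbT (cycle_path v) /= ql esym evq evp.
move=> x y; rewrite !inE => /predU1P[->|xl] /predU1P[->|yl].
- by rewrite eirr /cycle_dist idxv subnn min0n.
- by rewrite ecv // inE.
- have cdC : cycle_dist (v :: p :: l) x v = cycle_dist (v :: p :: l) v x.
    by rewrite /cycle_dist addnC.
  by rewrite esym cdC ecv // inE.
rewrite -!in_cons in xl yl.
have xE := nth_index p xl; have yE := nth_index p yl.
have nvx : v != x by apply: contraNneq nv => ->.
have nvy : v != y by apply: contraNneq nv => ->.
rewrite /cycle_dist !idx // [size _]/=.
move: (xl) (yl); rewrite -!index_mem.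
move: xE yE; move: (index x _) (index y _) => i j xE yE lti ltj.
have step a : a < size l -> e (nth p (p :: l) a) (nth p (p :: l) a.+1).
  by move=> la; move/(pathP p): el => /(_ a la).
have key a b : a <= b -> b < (size l).+1 ->
    e (nth p (p :: l) a) (nth p (p :: l) b) = (b - a == 1).
  move=> leab ltb; have [->|[eb|ltab]] : a = b \/ b = a.+1 \/ a.+1 < b.
    by clear -leab; lia.
  - by rewrite eirr subnn.
  - by rewrite eb subSnn step // -ltnS -eb.
  have := indl a b ltab ltb.
  rewrite /f (allP Sall _ (mem_nth p (ltb : b < size (p :: l)))) => /negPf /= ->.
  by clear -ltab; lia.
move: lti ltj; rewrite -xE -yE /= => lti ltj.
rewrite cycle_gap //; case: (leqP i j) => [le|/ltnW le]; last rewrite esym.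
  by rewrite key //; clear -le; lia.
by rewrite key //; clear -le; lia.
Qed.

(** * Holes in the closed neighborhood matrix *)

Definition closed_adj (T : finType) (e : rel T) (x y : T) := (x == y) || e x y.

(* [z] walks around a cycle of the bipartite graph of closed neighborhoods
   without chord; even and odd positions are the two sides. *)
Definition alternating_hole (T : finType) (e : rel T) (K : nat) (z : nat -> T) :=
  [/\ 6 <= K, ~~ odd K,
    forall p q, p < q -> q < K -> odd (q - p) ->
      closed_adj e (z p) (z q) = (q == p.+1) || (q - p == K.-1)
  & forall p q, p < q -> q < K -> ~~ odd (q - p) -> z p != z q].

(** Moves any two consecutive positions to the seam between [K.-1] and 0, the only place where their
    equality is refuted directly. *)
Lemma alternating_hole_rot1 (T : finType) (e : rel T) K z : symmetric e ->
  alternating_hole e K z ->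
  alternating_hole e K (fun i => if i == K.-1 then z 0 else z i.+1).
Proof.
move=> esym [K6 oK za zd].
have caC x y : closed_adj e x y = closed_adj e y x.
  by rewrite /closed_adj eq_sym esym.
split=> // p q ltpq ltq opq; rewrite (_ : (p == K.-1) = false); try lia.
  case: (q =P K.-1) => [qe | nq]; last by rewrite za; lia.
  by rewrite caC za; lia.
case: (q =P K.-1) => [qe | nq]; last by rewrite zd; lia.
by rewrite eq_sym zd; lia.
Qed.

(** A closed neighborhood contains its center, so consecutive positions could hold the same vertex.
    Such a vertex would have a detour around it along the rest of the hole, against chordality.
    Hence all positions are distinct, and the hole is an even cycle of the graph without odd
    chord. *)
Lemma closed_adj_hole_free (T : finType) (e : rel T) K z : 
  simple_graph e -> strongly_chordal e -> ~ alternating_hole e K z.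
Proof.
move=> [esym eirr] [che odc] hole.
have first_eq y : alternating_hole e K y -> y 0 != y K.-1.
  move=> [K6 oK za zd]; apply/eqP => eq0.
  have ev p : 0 < p < K.-1 -> e (y 0) (y p) = (p == 1) || (p == K.-2).
    move=> pK; have [op|op] := boolP (odd p).
    - have := za 0 p; rewrite /closed_adj; case: eqP => [y0p|_]; last by lia.
      by have /negP[] : y p != y K.-1; [apply: zd; lia | rewrite -y0p eq0].
    - have := za p K.-1; rewrite /closed_adj esym eq0.
      case: eqP => [ypK|_]; last by lia.
      by have /negP[] : y 0 != y p; [apply: zd; lia | rewrite ypK eq0].
  (* The detour avoids [y 0] and all its neighbors except [y 1] and [y K.-2]. *)
  pose S u := (u != y 0) && (e (y 0) u ==> (u \in [:: y 1; y K.-2])).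
  have neq0 p : 0 < p < K.-1 -> y p != y 0.
    move=> pK; have [op|op] := boolP (odd p).
      by rewrite eq0; apply: zd; lia.
    by rewrite eq_sym; apply: zd; lia.
  have Sp p : 0 < p < K.-1 -> S (y p).
    move=> pK; rewrite /S neq0 // ev //; apply/implyP.
    by case/orP => /eqP ->; rewrite !inE eqxx ?orbT.
  have far : closed_adj e (y 1) (y K.-2) = false by rewrite za; lia.
  have [n1 ne1] : y 1 != y K.-2 /\ ~~ e (y 1) (y K.-2).
    by move/negbT: far; rewrite negb_or => /andP.
  have := @chordal_no_detour T e (y 0) (y 1) (y K.-2) S esym eirr che.
  rewrite !ev ?n1 ?ne1; try lia.
  case/(_ _ _ _ _ _ _ _)/negP; try lia.
  - by rewrite /S eqxx.
  - by apply: Sp; lia.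
  - move=> u /andP[_ /implyP Su] /Su; rewrite !inE.
    by case/orP => /eqP ->; [left | right].
  (* Consecutive positions may still coincide here; such a step of the walk is void. *)
  have walk p : p < K.-2 -> connect (fun a b => S b && e a b) (y 1) (y p.+1).
    elim: p => [|p IHp] ltp; first exact: connect0.
    apply: connect_trans (IHp _) _; first by lia.
    have : closed_adj e (y p.+1) (y p.+2) by rewrite za; lia.
    case/orP => [/eqP <- | ep]; first exact: connect0.
    by apply: connect1; rewrite ep Sp //; lia.
  by have := walk (K - 3); rewrite (_ : (K - 3).+1 = K.-2); [apply; lia | lia].
(* [y] is [z] rotated by [p.+1], which puts [z p.+1] at position 0 and [z p] at position [K.-1]. *)
have next_neq p : p.+1 < K -> z p != z p.+1.
  move=> ltp; have [y [/first_eq y0 yE]] : exists y, alternating_hole e K y /\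
      forall i, i < K -> y i = z (if i + p.+1 < K then i + p.+1 else i + p.+1 - K).
    elim: p.+1 ltp => [|q IHq] ltq.
      by exists z; split=> // i lti; rewrite addn0 lti.
    have [|y [hy yE]] := IHq; first by lia.
    eexists; split; first exact: alternating_hole_rot1 hy.
    move=> i lti /=; case: eqP => [->|ni]; rewrite yE; try lia.
      by congr z; do 2 case: ifP; lia.
    by congr z; do 2 case: ifP; lia.
  move: y0; case: (hole) => K6 _ _ _; rewrite eq_sym !yE; try lia.
  by congr (z _ != z _); case: ifP; lia.
have last_neq := first_eq _ hole.
case: hole => K6 oK za zd.
have zneq p q : p < q -> q < K -> z p != z q.
  move=> ltpq ltq; have [opq | opq] := boolP (odd (q - p)); last exact: zd.
  have := za p q ltpq ltq opq; rewrite /closed_adj; case: eqVneq => // zpq.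
  move=> /= H; have {H}/orP[/eqP qe | qpK] : (q == p.+1) || (q - p == K.-1) by rewrite -H.
    by have := next_neq p; rewrite -qe zpq eqxx => /(_ ltq).
  by move: last_neq; rewrite (_ : 0 = p) 1?(_ : K.-1 = q) ?zpq ?eqxx //; lia.
have uz : uniq (mkseq z K).
  apply/mkseq_uniqP => p q; rewrite !inE => ltp ltq zpq.
  case: (ltngtP p q) => // [lt|gt]; first by move: (zneq _ _ lt ltq); rewrite zpq eqxx.
  by move: (zneq _ _ gt ltp); rewrite zpq eqxx.
have caz p q : p < q -> q < K -> odd (q - p) ->
    e (z p) (z q) = (q == p.+1) || (q - p == K.-1).
  by move=> lt ltq od; rewrite -za // /closed_adj (negPf (zneq _ _ lt ltq)).
have cyc : graph_cycle e (mkseq z K).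
  split; first by rewrite size_mkseq; lia.
  rewrite /ucycle uz andbT.
  have -> : mkseq z K = rcons (mkseq z K.-1) (z K.-1) by rewrite -mkseqS; congr mkseq; lia.
  rewrite (cycle_path (z 0)) last_rcons.
  apply/(pathP (z 0)) => i; rewrite size_rcons size_mkseq => lti.
  rewrite -mkseqS nth_mkseq //.
  case: i lti => [|i] lti /=; first by rewrite esym caz; lia.
  by rewrite nth_mkseq ?caz; lia.
have [||x [y [[xC yC exy ncd] ocd]]] := odc _ cyc; rewrite ?size_mkseq //.
case/(nthP (z 0)): xC => p; rewrite size_mkseq => ltp xE.
case/(nthP (z 0)): yC => q; rewrite size_mkseq => ltq yE.
move: exy ncd ocd; rewrite -xE -yE /cycle_dist !index_uniq ?size_mkseq // !nth_mkseq //.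
wlog lepq : p q ltp ltq {xE yE} / p <= q.
  move=> wl; case/orP: (leq_total p q) => le; first exact: wl.
  by rewrite esym addnC; apply: wl.
move=> epq ncd ocd.
have ltpq : p < q by rewrite ltn_neqAle lepq andbT; apply: contraTneq epq => ->; rewrite eirr.
move: epq; rewrite caz //; lia.
Qed.

(** * Doubly lexical orderings *)

Definition gamma_free (T : Type) (m : T -> T -> bool) (s t : T -> nat) :=
  forall r r' c c', s r < s r' -> t c < t c' ->
    m r c -> m r c' -> m r' c -> m r' c'.

(* The path [r_i - c_(i-1)], [r_i - c_(i+1)] with the two rails joined at the
   index [0]. *)
Definition rail i j := [|| (i == 0) && (j == 0), i == j.+1 | j == i.+1].

(** Joining the two free ends [r k.-1] and [c k.-1] of the path closes it to a chordless cycle of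
    length [2k]; the bound on [k] makes this length at least six. *)
Definition ladder (T : Type) (m : T -> T -> bool) k (r c : nat -> T) :=
  2 < k /\ forall i j, i < k -> j < k ->
    m (r i) (c j) = rail i j || (i == k.-1) && (j == k.-1).

Lemma ladder_rows_neq (T : eqType) (m : T -> T -> bool) k r c i j :
  ladder m k r c -> i < j -> j < k -> r i != r j.
Proof.
move=> [k2 lad] ltij ltj; apply/eqP => rij.
(* A column that meets row [i] and not row [j]: column [i.-1] meets no row after [i], except that
   column 0 also meets row 1. *)
pose q := if (i == 0) && (j == 1) then 1 else i.-1.
have ltq : q < k by rewrite /q; case: ifP; lia.
have := lad i q (ltn_trans ltij ltj) ltq; rewrite rij (lad j q ltj ltq).
rewrite /rail /q; case: ifP; lia.
Qed.

Lemma ladderT (T : Type) (m : T -> T -> bool) k r c :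
  ladder m k r c -> ladder (fun x y => m y x) k c r.
Proof. by move=> [k2 lad]; split=> // i j lti ltj; rewrite lad // /rail; lia. Qed.

(** The positions run down one rail from index [k.-1] to 0, cross there and run up the other rail.
    Rows and columns alternate, and the parity of [p + k] is chosen so that the crossing goes from
    [c 0] to [r 0]. *)
Lemma ladder_alternating_hole (T : finType) (e : rel T) k r c :
  symmetric e -> ladder (closed_adj e) k r c ->
  alternating_hole e k.*2
    (fun p => let i := if p < k then k.-1 - p else p - k in
              if odd (p + k) then c i else r i).
Proof.
move=> esym lad; have caC x y : closed_adj e x y = closed_adj e y x.
  by rewrite /closed_adj eq_sym esym.
have rneq i j : i != j -> i < k -> j < k -> r i != r j.
  case: (ltngtP i j) => // lt _ lti ltj; first exact: (ladder_rows_neq lad).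
  by rewrite eq_sym; apply: (ladder_rows_neq lad).
have cneq i j : i != j -> i < k -> j < k -> c i != c j.
  case: (ltngtP i j) => // lt _ lti ltj; first exact: (ladder_rows_neq (ladderT lad)).
  by rewrite eq_sym; apply: (ladder_rows_neq (ladderT lad)).
case: lad => k2 lad; split; try lia.
- move=> p q ltpq ltq opq /=.
  case op: (odd (p + k)); case oq: (odd (q + k)); try lia.
    by rewrite caC lad /rail; repeat (case: ifP => ?); lia.
  by rewrite lad /rail; repeat (case: ifP => ?); lia.
- move=> p q ltpq ltq opq /=.
  case op: (odd (p + k)); case oq: (odd (q + k)); try lia.
    by apply: cneq; repeat (case: ifP => ?); lia.
  by apply: rneq; repeat (case: ifP => ?); lia.
Qed.

(** Lexicographic order of the rows, with the column of largest [t] as the most significant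
    digit. *)
Definition row_lex (T : Type) (m : T -> T -> bool) (s t : T -> nat) :=
  forall r r' c, s r < s r' -> m r c -> ~~ m r' c ->
  exists c', [/\ t c < t c', m r' c', ~~ m r c' &
    forall x, t c' < t x -> m r x = m r' x].

(** A ladder under construction, seen from the rows and still open at its far end. The last clause
    says that rows [i] and [i.+1] differ for the last time at [c i.+2]; it controls the columns that
    are added later. *)
Definition rails (T : Type) (m : T -> T -> bool) (s t : T -> nat) k (r c : nat -> T) :=
  [/\ 1 < k, forall i, i.+1 < k -> s (r i) < s (r i.+1),
    forall i j, i < k -> j < k -> m (r i) (c j) = rail i j &
    forall i, i.+2 < k -> forall x, t (c i.+2) < t x -> m (r i) x = m (r i.+1) x].

(** At column [c k.-1] row [k.-2] has a one and row [k.-1] a zero, so the lexicographic order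
    provides a later column [c'] with these values exchanged. Beyond [c i.+2] rows [i] and [i.+1]
    agree, so the zero of row [k.-2] in column [c'] spreads to all earlier rows. *)
Lemma rails_next (T : Type) (m : T -> T -> bool) s t k r c :
  rails m s t k r c -> row_lex m s t ->
  (forall i j, i < j -> j < k -> t (c i) < t (c j)) ->
  exists c', [/\ t (c k.-1) < t c', m (r k.-1) c',
    forall i, i < k.-1 -> ~~ m (r i) c' &
    forall x, t c' < t x -> m (r k.-2) x = m (r k.-1) x].
Proof.
move=> [k1 sr pat agr] lex tc.
have [|||c' [tcc' mc' nmc' agr']] := lex (r k.-2) (r k.-1) (c k.-1).
- by have := sr k.-2; rewrite (_ : k.-2.+1 = k.-1); [apply; lia | lia].
- by rewrite pat /rail; lia.
- by rewrite pat /rail; lia.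
exists c'; split=> // i lti.
have down d : d <= k.-2 -> ~~ m (r (k.-2 - d)) c'.
  elim: d => [|d IHd] led; first by rewrite subn0.
  have := IHd (ltnW led); rewrite (_ : k.-2 - d = (k.-2 - d.+1).+1); last by lia.
  move jE: (k.-2 - d.+1) => j; have lt2 : j.+2 < k by lia.
  rewrite (agr j lt2) //; have [-> // | nk] := eqVneq j.+2 k.-1.
  by apply: ltn_trans tcc'; apply: tc; lia.
by have := down (k.-2 - i); rewrite subKn; [apply; lia | lia].
Qed.

Lemma rails_mono (T : Type) (m : T -> T -> bool) s t k r c i j :
  rails m s t k r c -> i < j -> j < k -> s (r i) < s (r j).
Proof.
move=> [_ sr _ _]; elim: j => // j IHj; rewrite ltnS leq_eqVlt => /predU1P[->|lt] ltj.
  exact: sr.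
by apply: ltn_trans (sr _ ltj); apply: IHj => //; apply: ltnW.
Qed.

(** [rails_next] is applied to the rows and to the columns. The only entry it leaves open is the new
    corner, and a one there would close a ladder. *)
Lemma rails_extend (T : Type) (m : T -> T -> bool) s t k r c :
  row_lex m s t -> row_lex (fun x y => m y x) t s ->
  (forall k r c, ~ ladder m k r c) ->
  rails m s t k r c -> rails (fun x y => m y x) t s k c r ->
  exists r' c', rails m s t k.+1 r' c' /\ rails (fun x y => m y x) t s k.+1 c' r'.
Proof.
move=> lexr lexc nolad rr rc.
have [c' [tc' mc' nmc' agc']] := rails_next rr lexr (fun i j => @rails_mono _ _ _ _ _ _ _ i j rc).
have [r' [tr' mr' nmr' agr']] := rails_next rc lexc (fun i j => @rails_mono _ _ _ _ _ _ _ i j rr).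
pose R i := if i == k then r' else r i; pose C i := if i == k then c' else c i.
case: (rr) (rc) => k1 sr pat agr [_ sc _ agc].
have Rk : R k = r' by rewrite /R eqxx.
have Ck : C k = c' by rewrite /C eqxx.
have Rl i : i < k -> R i = r i by move=> lti; rewrite /R ltn_eqF.
have Cl i : i < k -> C i = c i by move=> lti; rewrite /C ltn_eqF.
have lt_split i : i < k.+1 -> i = k \/ i < k by lia.
have patR i j : i < k.+1 -> j < k.+1 -> ~~ ((i == k) && (j == k)) ->
    m (R i) (C j) = rail i j.
  move=> /lt_split[->|lti] /lt_split[->|ltj]; rewrite ?eqxx //= => _.
  - rewrite Rk Cl // /rail; have [->|nj] := eqVneq j k.-1; first by rewrite mr'; lia.
    by rewrite (negPf (nmr' j _)); lia.
  - rewrite Ck Rl // /rail; have [->|ni] := eqVneq i k.-1; first by rewrite mc'; lia.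
    by rewrite (negPf (nmc' i _)); lia.
  - by rewrite Rl // Cl // pat.
have mkk : ~~ m r' c'.
  apply/negP => mk; apply: (nolad k.+1 R C); split; first by lia.
  move=> i j lti ltj; case: (boolP ((i == k) && (j == k))) => ij.
    by case/andP: ij => /eqP -> /eqP ->; rewrite Rk Ck mk /rail; lia.
  by rewrite patR //; move: ij; clear; lia.
have patF i j : i < k.+1 -> j < k.+1 -> m (R i) (C j) = rail i j.
  move=> lti ltj; case: (boolP ((i == k) && (j == k))) => ij; last exact: patR.
  by case/andP: ij => /eqP -> /eqP ->; rewrite Rk Ck (negPf mkk) /rail; lia.
have k2 : 1 < k.+1 by lia.
have kE i : i.+1 = k -> i = k.-1 by lia.
have kE2 i : i.+2 = k -> i = k.-2 /\ i.+1 = k.-1 by lia.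
have lt2 i : i.+1 < k -> i < k by lia.
exists R, C; split; split=> //.
- move=> i /lt_split[ik|lti].
    have ltik : i < k by rewrite -ik.
    by rewrite ik Rk (Rl i ltik) (kE i ik).
  by rewrite (Rl _ lti) (Rl _ (lt2 _ lti)) sr.
- move=> i /lt_split[ik|lti] x.
    case: (kE2 i ik) => i2 i1; have l1 : i.+1 < k by rewrite -ik.
    by rewrite ik Ck (Rl _ l1) (Rl _ (lt2 _ l1)) i1 i2; apply: agc'.
  by rewrite (Cl _ lti) (Rl _ (lt2 _ lti)) (Rl _ (lt2 _ (lt2 _ lti))); apply: agr.
- move=> i /lt_split[ik|lti].
    have ltik : i < k by rewrite -ik.
    by rewrite ik Ck (Cl i ltik) (kE i ik).
  by rewrite (Cl _ lti) (Cl _ (lt2 _ lti)) sc.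
- by move=> i j lti ltj; rewrite patF // /rail; clear; lia.
- move=> i /lt_split[ik|lti] x.
    case: (kE2 i ik) => i2 i1; have l1 : i.+1 < k by rewrite -ik.
    by rewrite ik Rk (Cl _ l1) (Cl _ (lt2 _ l1)) i1 i2; apply: agr'.
  by rewrite (Rl _ lti) (Cl _ (lt2 _ lti)) (Cl _ (lt2 _ (lt2 _ lti))); apply: agc.
Qed.

(** A forbidden configuration is a pair of rails of length two. Without ladders it can be extended
    for ever, but its rows are strictly increasing in a finite set. *)
Lemma doubly_lex_gamma_free (T : finType) (m : T -> T -> bool) s t :
  row_lex m s t -> row_lex (fun x y => m y x) t s ->
  (forall k r c, ~ ladder m k r c) -> gamma_free m s t.
Proof.
move=> lexr lexc nolad r r' c c' srr' tcc' mrc mrc' mr'c; apply/negPn/negP => nmr'c'.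
have long k : exists r0 c0, rails m s t k.+2 r0 c0 /\
    rails (fun x y => m y x) t s k.+2 c0 r0.
  elim: k => [|k [r0 [c0 [rr rc]]]]; last exact: rails_extend rr rc.
  exists (fun i => if i == 0 then r else r'), (fun i => if i == 0 then c else c').
  by split; split=> //; try (by case=> //); case=> [|[|i]] [|[|j]] //; rewrite ?(negPf nmr'c').
have [r0 [c0 [rr _]]] := long #|T|.
have : #|'I_#|T|.+2| <= #|T|.
  apply: (leq_card (fun i : 'I_#|T|.+2 => r0 i)) => i j rij; apply: val_inj => /=.
  case: (ltngtP i j) => // lt.
    by have := rails_mono rr lt (ltn_ord j); rewrite rij ltnn.
  by have := rails_mono rr lt (ltn_ord i); rewrite rij ltnn.
by rewrite card_ord; lia.
Qed.

(** * Doubly lexical orderings from a maximal weight *)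

Definition binval (T : finType) (t : T -> nat) (A : pred T) := \sum_(j | A j) 2 ^ t j.

Lemma binval_lt (T : finType) (t : T -> nat) (A : pred T) K :
  injective t -> (forall j, A j -> t j < K) -> binval t A < 2 ^ K.
Proof.
move=> tinj; elim: K A => [|K IHK] A Alt.
  by rewrite /binval big_pred0 ?expn0 // => j; apply/negP => /Alt.
have [j /andP[Aj /eqP tj]|noK] := pickP (fun j => A j && (t j == K)).
  rewrite /binval (bigD1 j) //= tj expnS mul2n -addnn -addnS leq_add2l.
  apply: IHK => i /andP[/Alt ti ij]; rewrite ltn_neqAle -ltnS ti andbT.
  by apply: contra_neq ij => tiK; apply: tinj; rewrite tj.
apply: leq_trans (IHK A _) _; last by rewrite leq_exp2l.
by move=> j Aj; rewrite ltn_neqAle -ltnS Alt // andbT; have := noK j; rewrite Aj /= => ->.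
Qed.

Lemma binval_lex (T : finType) (t : T -> nat) (A B : pred T) j0 : injective t ->
  A j0 -> ~~ B j0 -> (forall j, t j0 < t j -> A j = B j) -> binval t B < binval t A.
Proof.
move=> tinj Aj0 Bj0 AB; rewrite /binval.
rewrite (bigID (fun j => t j0 < t j)) [ltnRHS](bigID (fun j => t j0 < t j)) /=.
rewrite (eq_bigl (fun j => A j && (t j0 < t j))) ?ltn_add2l; last first.
  by move=> j; case: (boolP (t j0 < t j)) => lt; rewrite ?andbF // AB.
apply: (@leq_trans (2 ^ t j0)).
  apply: (binval_lt tinj) => j /andP[Bj]; rewrite -leqNgt => le.
  by rewrite ltn_neqAle le andbT; apply: contraNneq Bj0 => /tinj <-.
by rewrite (bigD1 j0) ?Aj0 ?ltnn //= leq_addr.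
Qed.

(** The witness is the last position where [A] and [B] differ; by [binval_lex] it cannot belong to
    [A]. *)
Lemma binval_leP (T : finType) (t : T -> nat) (A B : pred T) j : injective t ->
  binval t A <= binval t B -> A j -> ~~ B j ->
  exists j', [/\ t j < t j', B j', ~~ A j' & forall x, t j' < t x -> A x = B x].
Proof.
move=> tinj leAB Aj Bj.
have dj : A j != B j by rewrite Aj (negPf Bj).
case: (arg_maxnP (P := fun i => A i != B i) t dj) => j' dj' maxj.
have agr x : t j' < t x -> A x = B x.
  by move=> lt; apply/eqP; apply: contraLR lt => /maxj; rewrite -leqNgt.
have [Aj'|nAj'] := boolP (A j').
  have nBj' : ~~ B j' by move: dj'; rewrite Aj'; case: (B j').
  by have := binval_lex tinj Aj' nBj' agr; rewrite ltnNge leAB.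
have Bj' : B j' by move: dj'; rewrite (negPf nAj'); case: (B j').
exists j'; split=> //; rewrite ltn_neqAle (maxj j dj : t j <= t j') andbT.
by apply: contraNneq nAj' => /tinj <-.
Qed.

(* Maximizing [sum m i j 2^(s i + t j)] makes the binary values of the rows and
   of the columns increase, by rearrangement. *)
Lemma weight_row (n : nat) (m : 'I_n -> 'I_n -> bool) (s t : {perm 'I_n}) i i' :
  let w (s : {perm 'I_n}) := \sum_i 2 ^ s i * binval (fun j => t j) (m i) in
  (forall s', w s' <= w s) -> s i < s i' ->
  binval (fun j => t j) (m i) <= binval (fun j => t j) (m i').
Proof.
move=> w wmax lts; rewrite leqNgt; apply/negP => ltv.
have nii : i' != i by apply: contraTneq lts => ->; rewrite ltnn.
have := wmax (tperm i i' * s)%g; apply/negP; rewrite -ltnNge /w.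
rewrite (bigD1 i) // (bigD1 i') //= [ltnRHS](bigD1 i) // [X in _ < _ + X](bigD1 i') //=.
rewrite !permM tpermL tpermR !addnA.
under [X in _ < _ + X]eq_bigr => j /andP[ji ji'] do rewrite permM tpermD 1?eq_sym //.
rewrite ltn_add2r.
(* Exchanging the two rows changes the weight by the product of the differences of their powers of
   two and of their binary values; writing the first as [d.+1] makes it positive. *)
have [d sE] : exists d, 2 ^ s i' = 2 ^ s i + d.+1.
  have : 2 ^ s i < 2 ^ s i' by rewrite ltn_exp2l.
  by move=> lt; exists (2 ^ s i' - 2 ^ s i).-1; lia.
rewrite sE; move: (2 ^ _) (binval _ _) (binval _ _) ltv => a b c; nia.
Qed.

(** The same weight can be summed by rows and by columns, so a single maximizer is lexical in both
    directions. *)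
Lemma exists_gamma_free n (m : 'I_n -> 'I_n -> bool) :
  (forall k r c, ~ ladder m k r c) ->
  exists s t : {perm 'I_n}, gamma_free m (fun i => s i) (fun j => t j).
Proof.
move=> nolad.
pose w (p : {perm 'I_n} * {perm 'I_n}) := \sum_i \sum_(j | m i j) 2 ^ (p.1 i + p.2 j).
case: (arg_maxnP w (erefl true : xpredT (1%g, 1%g))) => -[s t] _ wmax.
have inj (p : {perm 'I_n}) : injective (fun i => p i : nat).
  by move=> i j /val_inj /perm_inj.
have wrow s' t' : w (s', t') = \sum_i 2 ^ s' i * binval (fun j => t' j) (m i).
  by apply: eq_bigr => i _; rewrite big_distrr; apply: eq_bigr => j _; rewrite expnD.
have wcol s' t' : w (s', t') =
    \sum_j 2 ^ t' j * binval (fun i => s' i) (fun i => m i j).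
  rewrite /w (exchange_big_dep xpredT) //=; apply: eq_bigr => j _.
  by rewrite big_distrr; apply: eq_bigr => i _; rewrite expnD mulnC.
exists s, t; apply: doubly_lex_gamma_free => //.
- move=> r r' c lts; apply: (binval_leP (inj t)).
  by apply: (@weight_row _ m s) lts => s'; rewrite -!wrow; apply: (wmax (s', t)).
- move=> c c' r lts; apply: (binval_leP (inj s)).
  by apply: (@weight_row _ (fun x y => m y x) t) lts => t'; rewrite -!wcol; apply: (wmax (s, t')).
Qed.

Lemma strongly_chordal_gamma_free n (e : rel 'I_n) :
  simple_graph e -> strongly_chordal e ->
  exists s t : {perm 'I_n}, gamma_free (closed_adj e) (fun i => s i) (fun j => t j).
Proof.
move=> sim sc; apply: exists_gamma_free => k r c /ladder_alternating_hole.
by move=> /(_ (proj1 sim)); apply: closed_adj_hole_free.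
Qed.

(** * Greedy orderings *)

(** A bounded quantifier over numbers instead of ordinals, since this is what the terms of the
    program evaluate to. *)
Definition exn n (P : pred nat) := has P (iota 0 n).

Lemma exnP n (P : pred nat) : reflect (exists2 i, i < n & P i) (exn n P).
Proof.
by apply: (iffP hasP) => -[i]; rewrite ?mem_iota => lti Pi; exists i; rewrite ?mem_iota.
Qed.

Lemma eq_exn n (P Q : pred nat) : (forall i, i < n -> P i = Q i) -> exn n P = exn n Q.
Proof. by move=> PQ; apply: eq_in_has => i; rewrite mem_iota => /PQ. Qed.

Section Greedy.
Variables (P : seq nat -> pred nat) (n : nat).

(** The value is [n] when the search fails, which [P_ex] excludes for the greedy picks. *)
Definition least (Q : pred nat) := find Q (iota 0 n).

Fixpoint greedy i : seq nat :=
  if i is j.+1 then rcons (greedy j) (least (P (greedy j))) else [::].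

Definition greedy_pick i := least (P (greedy i)).

Lemma greedyE i : greedy i = mkseq greedy_pick i.
Proof. by elim: i => // i IHi; rewrite mkseqS -IHi. Qed.

Lemma least_lt (Q : pred nat) c : c < n -> Q c -> least Q < n /\ Q (least Q).
Proof.
move=> ltc Qc; have hQ : has Q (iota 0 n) by apply/hasP; exists c; rewrite ?mem_iota.
have lt := hQ; rewrite has_find size_iota in lt; split=> //.
by have := nth_find 0 hQ; rewrite nth_iota.
Qed.

Hypothesis P_new : forall l c, P l c -> c \notin l.
Hypothesis P_ex : forall l, uniq l -> all (fun c => c < n) l -> size l < n ->
  exists2 c, c < n & P l c.

Lemma greedy_ok i : i <= n -> uniq (greedy i) /\ all (fun c => c < n) (greedy i).
Proof.
elim: i => //= i IHi lti; have [ug ag] := IHi (ltnW lti).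
have szg : size (greedy i) = i by rewrite greedyE size_mkseq.
have [|c ltc Pc] := P_ex ug ag; first by rewrite szg.
have [lt Pl] := least_lt ltc Pc.
by rewrite rcons_uniq all_rcons ug ag lt P_new.
Qed.

Lemma greedy_pickP i : i < n -> greedy_pick i < n /\ P (greedy i) (greedy_pick i).
Proof.
move=> lti; have [ug ag] := greedy_ok (ltnW lti).
have [|c ltc Pc] := P_ex ug ag; first by rewrite greedyE size_mkseq.
exact: least_lt ltc Pc.
Qed.

Lemma greedy_pick_neq i j : i < j -> j < n -> greedy_pick i != greedy_pick j.
Proof.
move=> ltij /greedy_pickP[_ /P_new]; apply: contraNneq => <-.
by rewrite greedyE map_f // mem_iota.
Qed.

Lemma greedy_pick_inj i j : i < n -> j < n -> greedy_pick i = greedy_pick j -> i = j.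
Proof.
move=> lti ltj pij; case: (ltngtP i j) => // lt.
  by have := greedy_pick_neq lt ltj; rewrite pij eqxx.
by have := greedy_pick_neq lt lti; rewrite pij eqxx.
Qed.

End Greedy.

Lemma exists_minimal_outside n (l : seq nat) (f : nat -> nat) :
  size l < n -> uniq l -> all (fun c => c < n) l ->
  exists c, [/\ c < n, c \notin l & forall d, d < n -> d \notin l -> f c <= f d].
Proof.
move=> szl ul al.
have [x0 x0l] : exists x : 'I_n, (x : nat) \notin l.
  apply/existsP; apply: contraLR szl => /existsPn nex; rewrite -leqNgt.
  rewrite -[n]card_ord cardE -(size_map val).
  apply: uniq_leq_size; first by rewrite (map_inj_uniq val_inj) enum_uniq.
  by move=> _ /mapP[x _ ->]; apply: negbNE; apply: nex.
case: (arg_minnP (P := fun x : 'I_n => (x : nat) \notin l) (fun x => f x) x0l) => c cl cmin.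
by exists c; split=> // d ltd; apply: (cmin (Ordinal ltd)).
Qed.

(** Greedy orders and program handle plain numbers. The relation is false out of range, so an entry
    bounds its own indices. *)
Definition nat_adj n (e : rel 'I_n) i j :=
  [exists x : 'I_n, exists y : 'I_n, [&& x == i :> nat, y == j :> nat & closed_adj e x y]].

Lemma nat_adjE n (e : rel 'I_n) (x y : 'I_n) : nat_adj e x y = closed_adj e x y.
Proof.
apply/existsP/idP => [[x' /existsP[y' /and3P[/eqP xx /eqP yy]]]|exy].
  by rewrite (val_inj xx) (val_inj yy).
by exists x; apply/existsP; exists y; rewrite !eqxx.
Qed.

Lemma nat_adj_lt n (e : rel 'I_n) i j : nat_adj e i j -> i < n /\ j < n.
Proof. by move=> /existsP[x /existsP[y /and3P[/eqP <- /eqP <- _]]]. Qed.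

(** * Sorting the columns, then the rows *)

Section Sorting.
Variables (n : nat) (E : nat -> nat -> bool).

(* The rows through column [c] form a chain on the columns outside [l]. *)
Definition nest_col (l : seq nat) c := (c \notin l) &&
  ~~ exn n (fun r => exn n (fun r' => exn n (fun d => exn n (fun d' =>
    [&& E r c, E r' c, d \notin l, d' \notin l,
        E r d && ~~ E r' d & E r' d' && ~~ E r d'])))).

Definition col_order := greedy_pick nest_col n.

Definition low_row (l : seq nat) r := (r \notin l) &&
  ~~ exn n (fun r' => exn n (fun j => exn n (fun j' =>
    [&& r' \notin l, j < j', E r (col_order j), E r (col_order j'),
        E r' (col_order j) & ~~ E r' (col_order j')]))).

Definition row_order := greedy_pick low_row n.

Definition sorted_adj i j := [&& i < n, j < n & E (row_order i) (col_order j)].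

Variables s t : nat -> nat.
Hypothesis s_inj : forall i j, i < n -> j < n -> s i = s j -> i = j.
Hypothesis t_inj : forall i j, i < n -> j < n -> t i = t j -> i = j.
Hypothesis E_gamma : gamma_free E s t.

Lemma nest_col_new l c : nest_col l c -> c \notin l.
Proof. by case/andP. Qed.

Lemma low_row_new l r : low_row l r -> r \notin l.
Proof. by case/andP. Qed.

(** The remaining column of least [t] qualifies: of any two of its rows, [E_gamma] makes the one
    with larger [s] contain the other on the remaining columns. *)
Lemma nest_col_ex l : uniq l -> all (fun c => c < n) l -> size l < n ->
  exists2 c, c < n & nest_col l c.
Proof.
move=> ul al szl; have [c [ltc cl cmin]] := exists_minimal_outside t szl ul al.
exists c => //; rewrite /nest_col cl /=.
apply/negP => /exnP[r ltr /exnP[r' ltr' /exnP[d ltd /exnP[d' ltd']]]].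
case/and5P => Erc Er'c dl d'l /andP[/andP[Erd nEr'd] /andP[Er'd' nErd']].
have tlt x : x < n -> x \notin l -> c != x -> t c < t x.
  move=> ltx xl cx; rewrite ltn_neqAle cmin // andbT.
  by apply: contra_neq cx; apply: t_inj.
case: (ltngtP (s r) (s r')) => [lt|lt|/s_inj rr].
- have /negP[] := nEr'd; apply: (E_gamma lt (tlt d ltd dl _) Erc Erd Er'c).
  by apply: contraNneq nEr'd => <-.
- have /negP[] := nErd'; apply: (E_gamma lt (tlt d' ltd' d'l _) Er'c Er'd' Erc).
  by apply: contraNneq nErd' => <-.
- by move: nEr'd; rewrite -rr // Erd.
Qed.

Lemma col_lt i : i < n -> col_order i < n.
Proof. by move=> /(greedy_pickP nest_col_new nest_col_ex)[]. Qed.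

Lemma col_inj i j : i < n -> j < n -> col_order i = col_order j -> i = j.
Proof. exact: (greedy_pick_inj nest_col_new nest_col_ex). Qed.

Lemma col_later i j : i <= j -> j < n -> col_order j \notin greedy nest_col n i.
Proof.
move=> leij ltj; rewrite greedyE; apply/mapP => -[k].
rewrite mem_iota add0n => /= ltki /(col_inj ltj) jk.
by have := jk (ltn_trans (leq_trans ltki leij) ltj); lia.
Qed.

(** The remaining row of least binary value in the column order qualifies. If it formed a bad
    configuration with [r'] at columns [j < j'], then [r'] would own a column beyond [j'] that [r]
    lacks, and the two rows would not be nested when column [j] was picked. *)
Lemma low_row_ex l : uniq l -> all (fun c => c < n) l -> size l < n ->
  exists2 c, c < n & low_row l c.
Proof.
move=> ul al szl.
pose A r (j : 'I_n) := E r (col_order j).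
have [r [ltr rl rmin]] :=
  exists_minimal_outside (fun r => binval (fun j : 'I_n => j) (A r)) szl ul al.
exists r => //; rewrite /low_row rl /=.
apply/negP => /exnP[r' ltr' /exnP[j ltj /exnP[j' ltj']]].
case/and5P => r'l ltjj' Erj Erj' /andP[Er'j nEr'j'].
have [||||x [/= ltx Ar'x nArx _]] := @binval_leP _ (fun j : 'I_n => j) (A r) (A r') (Ordinal ltj').
- exact: val_inj.
- exact: rmin.
- exact: Erj'.
- exact: nEr'j'.
have [_ /andP[_ /negP[]]] := greedy_pickP nest_col_new nest_col_ex ltj.
apply/exnP; exists r => //; apply/exnP; exists r' => //.
apply/exnP; exists (col_order j'); first exact: col_lt.
apply/exnP; exists (col_order x); first exact: col_lt.
have [lejj' lejx] := (ltnW ltjj', ltnW (ltn_trans ltjj' ltx)).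
rewrite -/(col_order j) Erj Er'j !col_later ?Erj' ?nEr'j' //.
by rewrite -/(A r' x) Ar'x -/(A r x) nArx.
Qed.

Lemma row_lt i : i < n -> row_order i < n.
Proof. by move=> /(greedy_pickP low_row_new low_row_ex)[]. Qed.

Lemma row_inj i j : i < n -> j < n -> row_order i = row_order j -> i = j.
Proof. exact: (greedy_pick_inj low_row_new low_row_ex). Qed.

Lemma sorted_adj_gamma : gamma_free sorted_adj id id.
Proof.
move=> i i' j j' ltii' ltjj' /and3P[lti ltj Eij] /and3P[_ ltj' Eij'] /and3P[lti' _ Ei'j].
apply/and3P; split=> //; apply/negPn/negP => nE.
have [_ /andP[_ /negP[]]] := greedy_pickP low_row_new low_row_ex lti.
apply/exnP; exists (row_order i'); first exact: row_lt.
apply/exnP; exists j => //; apply/exnP; exists j' => //.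
rewrite -/(row_order i) ltjj' Eij Eij' Ei'j nE !andbT greedyE.
apply/mapP => -[k]; rewrite mem_iota add0n => /= ltk /(row_inj lti') ik.
by have := ik (ltn_trans ltk lti); lia.
Qed.

End Sorting.

Lemma nat_adj_gamma_free n (e : rel 'I_n) : simple_graph e -> strongly_chordal e ->
  exists s t : nat -> nat,
  [/\ forall i j, i < n -> j < n -> s i = s j -> i = j,
      forall i j, i < n -> j < n -> t i = t j -> i = j &
      gamma_free (nat_adj e) s t].
Proof.
move=> sim sc; have [s [t gf]] := strongly_chordal_gamma_free sim sc.
(* The default 0 is never compared, because entries of [nat_adj] bound their indices. *)
pose f (p : {perm 'I_n}) i := if insub i is Some x then p x : nat else 0.
have fE p (x : 'I_n) : f p x = p x by rewrite /f valK.
have fI p i j : i < n -> j < n -> f p i = f p j -> i = j.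
  move=> lti ltj; rewrite -[i]/(val (Ordinal lti)) -[j]/(val (Ordinal ltj)) !fE.
  by move/val_inj/perm_inj ->.
exists (f s), (f t); split; [exact: fI | exact: fI |].
move=> r r' c c' lts ltt rc; have [ltr ltc] := nat_adj_lt rc.
move=> rc' r'c; have [[_ ltc'] [ltr' _]] := (nat_adj_lt rc', nat_adj_lt r'c).
move: lts ltt rc rc' r'c.
rewrite -[r]/(val (Ordinal ltr)) -[r']/(val (Ordinal ltr')).
rewrite -[c]/(val (Ordinal ltc)) -[c']/(val (Ordinal ltc')) !fE !nat_adjE.
exact: gf.
Qed.

(** * Dynamic programming on a sorted matrix *)

Section ZeroBlock.
Variables (T1 T2 : finType) (m : T1 -> T2 -> bool).
Implicit Types (S B : {set T1}) (V W : {set T2}).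

Definition zero_block S V u k := [exists B : {set T1}, exists W : {set T2},
  [&& B \subset S, W \subset V, #|B| == u, #|W| == k &
      [forall b in B, forall c in W, ~~ m b c]]].

Lemma zero_blockP S V u k : reflect (exists B W, [/\ B \subset S, W \subset V,
    #|B| = u, #|W| = k & {in B & W, forall b c, ~~ m b c}])
  (zero_block S V u k).
Proof.
apply: (iffP existsP) => [[B /existsP[W]] | [B [W [BS WV Bu Wk Z]]]].
  case/and5P => BS WV /eqP Bu /eqP Wk /forall_inP Z.
  by exists B, W; split=> // b c bB cW; apply: (forall_inP (Z b bB)).
exists B; apply/existsP; exists W; rewrite BS WV Bu Wk !eqxx /=.
by apply/forall_inP => b bB; apply/forall_inP => c cW; apply: Z.
Qed.

Lemma exists_subset (T : finType) (A : {set T}) k :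
  k <= #|A| -> exists2 B : {set T}, B \subset A & #|B| = k.
Proof.
move=> /card_geqP[s [us ss sA]]; exists [set x in s].
  by apply/subsetP => x; rewrite inE => /sA.
by rewrite cardsE (card_uniqP us).
Qed.

Lemma zero_block_set0 V u k : zero_block set0 V u k = (u == 0) && (k <= #|V|).
Proof.
apply/zero_blockP/andP => [[B [W []]] | [/eqP -> /exists_subset[W WV Wk]]].
  by rewrite subset0 => /eqP -> WV <- <- _; rewrite cards0 subset_leq_card.
by exists set0, W; rewrite cards0; split=> // b c; rewrite inE.
Qed.

Lemma zero_block_singleton a u k : zero_block [set a] set0 u k = (k == 0) && (u <= 1).
Proof.
apply/zero_blockP/andP => [[B [W []]] | [/eqP -> leu]].
  by move=> Ba; rewrite subset0 => /eqP -> <- <- _; rewrite cards0 -(cards1 a) subset_leq_card.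
have [B Ba Bu] : exists2 B : {set T1}, B \subset [set a] & #|B| = u.
  by apply: exists_subset; rewrite cards1.
by exists B, set0; rewrite cards0; split=> // b c _; rewrite inE.
Qed.

Lemma zero_block_column S V x u k : x \notin V ->
  zero_block S (x |: V) u k =
  zero_block S V u k || (0 < k) && zero_block [set g in S | ~~ m g x] V u k.-1.
Proof.
move=> xV; apply/zero_blockP/orP.
  move=> [B [W [BS WV Bu Wk Z]]]; have [xW|xW] := boolP (x \in W); last first.
    left; apply/zero_blockP; exists B, W; split=> //.
    apply/subsetP => c cW; have := subsetP WV c cW; rewrite !inE.
    by case/predU1P => // cx; rewrite -cx cW in xW.
  right; rewrite -Wk (cardsD1 x) xW /=; apply/zero_blockP.
  exists B, (W :\ x); split=> //.
  - by apply/subsetP => b bB; rewrite inE (subsetP BS) //= Z.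
  - apply/subsetP => c; rewrite !inE => /andP[cx cW].
    by have := subsetP WV c cW; rewrite !inE (negPf cx).
  - by move=> b c bB; rewrite !inE => /andP[_]; apply: Z.
case=> [/zero_blockP | /andP[k0 /zero_blockP]] [B [W [BS WV Bu Wk Z]]].
  by exists B, W; split=> //; apply: subset_trans WV (subsetUr _ _).
have xW : x \notin W by apply: contra xV; apply: (subsetP WV).
exists B, (x |: W); split=> //.
- by apply: subset_trans BS _; apply/subsetP => g; rewrite inE => /andP[].
- exact: setUS.
- by rewrite cardsU1 xW Wk add1n prednK.
- move=> b c bB; rewrite !inE => /predU1P[-> | cW]; last exact: Z.
  by have := subsetP BS b bB; rewrite inE => /andP[].
Qed.

(** No entry links a part to the other, so the choices in the two parts are independent and only
    their sizes are combined. *)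
Lemma zero_block_union S1 S2 V1 V2 u k :
  [disjoint S1 & S2] -> [disjoint V1 & V2] ->
  {in S1 & V2, forall g c, ~~ m g c} -> {in S2 & V1, forall g c, ~~ m g c} ->
  zero_block (S1 :|: S2) (V1 :|: V2) u k =
  exn u.+1 (fun u' => exn k.+1 (fun k' =>
    zero_block S1 V1 (u - u') (k - k') && zero_block S2 V2 u' k')).
Proof.
move=> dS dV Z12 Z21; apply/zero_blockP/exnP.
  move=> [B [W [BS WV Bu Wk Z]]].
  have Bsum : #|B| = #|B :&: S1| + #|B :&: S2|.
    rewrite -cardsUI -setIUr (setIidPl BS) setIACA setIid.
    by move: dS; rewrite -setI_eq0 => /eqP ->; rewrite setI0 cards0 addn0.
  have Wsum : #|W| = #|W :&: V1| + #|W :&: V2|.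
    rewrite -cardsUI -setIUr (setIidPl WV) setIACA setIid.
    by move: dV; rewrite -setI_eq0 => /eqP ->; rewrite setI0 cards0 addn0.
  exists #|B :&: S2|; first by rewrite ltnS -Bu Bsum leq_addl.
  apply/exnP; exists #|W :&: V2|; first by rewrite ltnS -Wk Wsum leq_addl.
  rewrite -Bu -Wk {1}Bsum {1}Wsum !addnK.
  apply/andP; split; apply/zero_blockP.
    exists (B :&: S1), (W :&: V1); split; rewrite ?subsetIr //.
    by move=> b c; rewrite !inE => /andP[bB _] /andP[cW _]; apply: Z.
  exists (B :&: S2), (W :&: V2); split; rewrite ?subsetIr //.
  by move=> b c; rewrite !inE => /andP[bB _] /andP[cW _]; apply: Z.
move=> [u' leu /exnP[k' lek /andP[]]]; rewrite !ltnS in leu lek.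
move=> /zero_blockP[B1 [W1 [BS1 WV1 Bu1 Wk1 Z1]]] /zero_blockP[B2 [W2 [BS2 WV2 Bu2 Wk2 Z2]]].
exists (B1 :|: B2), (W1 :|: W2); split; try exact: setUSS.
- by rewrite cardsU disjoint_setI0 ?cards0 ?(disjointWl BS1 (disjointWr BS2 dS)) // Bu1 Bu2; lia.
- by rewrite cardsU disjoint_setI0 ?cards0 ?(disjointWl WV1 (disjointWr WV2 dV)) // Wk1 Wk2; lia.
move=> b c; rewrite !inE => /orP[bB|bB] /orP[cW|cW].
- exact: Z1.
- by apply: Z12; [apply: (subsetP BS1) | apply: (subsetP WV2)].
- by apply: Z21; [apply: (subsetP BS2) | apply: (subsetP WV1)].
- exact: Z2.
Qed.

End ZeroBlock.

(** * The forest of rows that share a column *)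

Section Forest.
Variables (n : nat) (m : nat -> nat -> bool).
Hypothesis m_lt : forall i j, m i j -> i < n /\ j < n.
Hypothesis m_gamma : gamma_free m id id.

Definition mo (g c : 'I_n) := m g c.

Definition share x f g := exn x (fun j => m f j && m g j).

Definition down x : rel 'I_n := fun f h => (h < f) && share x f h.

(** Several rows may lead down to the same row; that reachability is nevertheless a forest order is
    [descend_chain]. *)
Definition descend x (f : 'I_n) : {set 'I_n} := [set g | connect (down x) f g].

Lemma shareC x f g : share x f g = share x g f.
Proof. by apply: eq_exn => j _; rewrite andbC. Qed.

(** Whichever of [g] and [g'] meets [h] in the earlier column also meets the later one, by [m_gamma]
    applied above [h]. *)
Lemma share_up x h g g' : h < g -> h < g' -> share x h g -> share x h g' -> share x g g'.
Proof.
move=> ltg ltg' /exnP[j ltj /andP[mhj mgj]] /exnP[j' ltj' /andP[mhj' mg'j']].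
apply/exnP; case: (ltngtP j j') => [lt|lt|jj].
- by exists j' => //; rewrite mg'j' (m_gamma ltg lt mhj mhj' mgj).
- by exists j => //; rewrite mgj (m_gamma ltg' lt mhj' mhj mg'j').
- by exists j => //; rewrite mgj jj mg'j'.
Qed.

Lemma descend_refl x f : f \in descend x f.
Proof. by rewrite inE connect0. Qed.

Lemma descend_trans x f g h : g \in descend x f -> h \in descend x g -> h \in descend x f.
Proof. by rewrite !inE; apply: connect_trans. Qed.

Lemma descend_down x f h : down x f h -> h \in descend x f.
Proof. by rewrite inE; apply: connect1. Qed.

Lemma descendE x f g :
  (g \in descend x f) = (g == f) || [exists h, down x f h && (g \in descend x h)].
Proof.
apply/idP/orP => [|[/eqP ->|/existsP[h /andP[fh gh]]]].
- rewrite inE => /connectP[[|h p] /= ]; first by move=> _ ->; left.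
  move=> /andP[fh ph] gE; right; apply/existsP; exists h; rewrite fh inE /=.
  by apply/connectP; exists p.
- exact: descend_refl.
- exact: descend_trans (descend_down fh) gh.
Qed.

Lemma descend_ind x g (Q : 'I_n -> Prop) : Q g ->
  (forall f h : 'I_n, h < f -> share x f h -> g \in descend x h -> Q h -> Q f) ->
  forall f, g \in descend x f -> Q f.
Proof.
move=> Qg Qs f; have [k] := ubnP (f : nat); elim: k f => // k IHk f ltf.
rewrite descendE => /predU1P[<- // | /existsP[h /andP[/andP[lth sh] gh]]].
by apply: (Qs f h lth sh gh); apply: IHk gh; apply: leq_trans lth ltf.
Qed.

(** Each step of the descent shares a column [c < x], hence [c <= j], and [m_gamma] hands column [j]
    up from the lower row to the higher one. The case [j = x.-1] is the one used when column [x] is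
    decided in a descent at [x.+1]. *)
Lemma descend_col x f g j : g \in descend x f -> x <= j.+1 -> m g j -> m f j.
Proof.
move=> gf lexj; elim/(@descend_ind x g): f / gf => // f h lth /exnP[c ltc /andP[mfc mhc]] _ IH mgj.
have := IH mgj; have [<- // | nc mhj] := eqVneq c j.
by apply: m_gamma lth _ mhc mhj mfc; lia.
Qed.

Lemma descend_last x f g : g \in descend x f -> g != f ->
  exists h : 'I_n, [/\ g < h, share x h g & h \in descend x f].
Proof.
move=> gf; elim/(@descend_ind x g): f / gf => [|f h lth sh gh IH _]; first by rewrite eqxx.
have [gE|ng] := eqVneq g h; first by exists f; rewrite gE lth descend_refl.
have [h' [lt sh' h'h]] := IH ng.
by exists h'; split=> //; apply: descend_trans h'h; apply: descend_down; rewrite /down lth.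
Qed.

Lemma descend_le x f g : g \in descend x f -> g <= f.
Proof. by move=> gf; elim/(@descend_ind x g): f / gf => // f h lth _ _; lia. Qed.

(** The rows just above [g] on the two descents share a column by [share_up], so the lower of them
    lies below both [f] and [f']. It is larger than [g], whence the induction on [n - g]. *)
Lemma descend_chain x f f' g : g \in descend x f -> g \in descend x f' -> f <= f' ->
  f \in descend x f'.
Proof.
have [k] := ubnP (n - g); elim: k g => // k IHk g ltk gf gf' leff'.
have [gE|ngf] := eqVneq g f; first by rewrite -gE.
have [gE|ngf'] := eqVneq g f'.
  have := descend_le gf; rewrite gE => lef'f.
  by rewrite (_ : f = f') ?descend_refl //; apply: val_inj; apply/eqP; rewrite eqn_leq leff'.
have [h [ltgh sh hf]] := descend_last gf ngf.
have [h' [ltgh' sh' h'f']] := descend_last gf' ngf'.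
have hh' : share x h h' by apply: (share_up ltgh ltgh'); rewrite shareC.
have ltn_k (a : 'I_n) : g < a -> n - a < k by have := ltn_ord a; clear -ltk; lia.
case: (ltngtP h h') => [lt|lt|/val_inj E].
- apply: (IHk h) => //; first exact: ltn_k.
  by apply: descend_trans h'f' _; apply: descend_down; rewrite /down lt shareC.
- apply: (IHk h') => //; first exact: ltn_k.
  by apply: descend_trans hf _; apply: descend_down; rewrite /down lt.
- by apply: (IHk h) => //; [exact: ltn_k | rewrite E].
Qed.

Lemma descend_mono x f g : g \in descend x f -> g \in descend x.+1 f.
Proof.
move=> gf; elim/(@descend_ind x g): f / gf => [|f h lth /exnP[j ltj sj] _ IH].
  exact: descend_refl.
apply: descend_trans IH; apply: descend_down; rewrite /down lth.
by apply/exnP; exists j => //; apply: ltnW.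
Qed.

Lemma descend0 f : descend 0 f = [set f].
Proof.
apply/setP => g; rewrite descendE inE; case: eqP => //= _.
by apply/existsP => -[h /andP[/andP[_ /exnP[]]]].
Qed.

(** * Splitting a set of rows closed under descent at its roots *)

Section Roots.
Variables (x : nat) (S : {set 'I_n}).
Hypothesis S_closed : forall f, f \in S -> descend x f \subset S.

Definition is_root (f : 'I_n) :=
  (f \in S) && ~~ [exists g : 'I_n, [&& g \in S, f < g & share x g f]].

Definition prefix k : {set 'I_n} :=
  [set g | [exists f : 'I_n, [&& f < k, is_root f & g \in descend x f]]].

Definition cols (A : {set 'I_n}) : {set 'I_n} :=
  [set c : 'I_n | (c < x) && [exists g : 'I_n, (g \in A) && m g c]].

Lemma prefix0 : prefix 0 = set0.
Proof. by apply/setP => g; rewrite !inE; apply/existsP => -[]. Qed.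

Lemma prefix_succ (f : 'I_n) :
  prefix f.+1 = if is_root f then prefix f :|: descend x f else prefix f.
Proof.
apply/setP => g; apply/idP/idP.
  rewrite inE => /existsP[f' /and3P[]]; rewrite ltnS leq_eqVlt => /predU1P[/val_inj -> -> gf|lt rf gf].
    by rewrite in_setU gf orbT.
  by case: ifP => _; rewrite ?in_setU inE; [apply/orP; left|]; apply/existsP; exists f'; rewrite lt rf.
case: ifP => rf; rewrite ?in_setU; first case/orP.
- rewrite !inE => /existsP[f' /and3P[lt rf' gf]]; apply/existsP; exists f'.
  by rewrite rf' gf ltnS ltnW.
- by move=> gf; rewrite inE; apply/existsP; exists f; rewrite rf gf ltnSn.
- rewrite !inE => /existsP[f' /and3P[lt rf' gf]]; apply/existsP; exists f'.
  by rewrite rf' gf ltnS ltnW.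
Qed.

Lemma prefix_all : prefix n = S.
Proof.
apply/setP => g; apply/idP/idP.
  rewrite inE => /existsP[f /and3P[_ /andP[fS _] gf]].
  exact: (subsetP (S_closed fS)).
have [k] := ubnP (n - g); elim: k g => // k IHk g ltk gS.
have [rg|] := boolP (is_root g).
  by rewrite inE; apply/existsP; exists g; rewrite ltn_ord rg descend_refl.
rewrite /is_root gS /= negbK => /existsP[h /and3P[hS lt sh]].
have := IHk h _ hS; rewrite !inE => /(_ _)/existsP[].
  by have := ltn_ord h; clear -ltk lt; lia.
move=> f /and3P[ltf rf hf]; apply/existsP; exists f; rewrite ltf rf.
by apply: descend_trans hf _; apply: descend_down; rewrite /down lt.
Qed.

(** By [descend_chain] the smaller root lies below the larger one. The row just above it on that
    descent belongs to [S] and contradicts that it is a root. *)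
Lemma root_unique f f' g : is_root f -> is_root f' ->
  g \in descend x f -> g \in descend x f' -> f = f'.
Proof.
wlog le : f f' / f <= f'.
  by move=> wl rf rf' gf gf'; case/orP: (leq_total f f') => le; [|symmetry]; apply: wl.
move=> /andP[_ rf] /andP[f'S _] gf gf'; apply/eqP; apply: contraNT rf => nff.
have [h [lt sh hf']] := descend_last (descend_chain gf gf' le) nff.
by apply/existsP; exists h; rewrite lt sh (subsetP (S_closed f'S)).
Qed.

Lemma root_share f f' g g' : is_root f -> is_root f' ->
  g \in descend x f -> g' \in descend x f' -> share x g g' -> f = f'.
Proof.
wlog le : f f' g g' / g <= g'.
  move=> wl rf rf' gf gf' sg; case/orP: (leq_total g g') => le; first exact: (wl _ _ g g').
  by symmetry; apply: (wl _ _ g' g) => //; rewrite shareC.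
move=> rf rf' gf gf' sg; apply: root_unique rf rf' gf _.
have [/val_inj -> //|ng] := eqVneq (g : nat) g'.
by apply: descend_trans gf' _; apply: descend_down; rewrite /down ltn_neqAle ng le shareC.
Qed.

Lemma in_prefix g k : g \in prefix k ->
  exists f : 'I_n, [/\ f < k, is_root f & g \in descend x f].
Proof. by rewrite inE => /existsP[f /and3P[]]; exists f. Qed.

Lemma cols_share (c g : 'I_n) (A : {set 'I_n}) :
  m g c -> c \in cols A -> exists2 g', g' \in A & share x g g'.
Proof.
move=> mgc; rewrite inE => /andP[ltc /existsP[g' /andP[g'A mg'c]]].
by exists g' => //; apply/exnP; exists c => //; rewrite mgc.
Qed.

Lemma colsU (A B : {set 'I_n}) : cols (A :|: B) = cols A :|: cols B.
Proof.
apply/setP => c; rewrite !inE -andb_orr; congr andb; apply/existsP/orP.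
  by case=> g; rewrite inE andb_orl => /orP[] gc; [left|right]; apply/existsP; exists g.
by case=> /existsP[g /andP[gA mgc]]; exists g; rewrite inE gA mgc ?orbT.
Qed.

Variable F : {set 'I_n}.
Hypothesis F_free : {in S & F, forall g c, ~~ mo g c}.

(** The columns of [F] meet no row of [S]; they are counted from the start, where any number of them
    may be white. *)
Definition cell k u w := zero_block mo (prefix k) (F :|: cols (prefix k)) u w.

Lemma cell0 u w : cell 0 u w = (u == 0) && (w <= #|F|).
Proof.
rewrite /cell prefix0 zero_block_set0 (_ : cols set0 = set0) ?setU0 //.
by apply/setP => c; rewrite !inE; apply/negbTE/nandP; right; apply/existsP => -[g]; rewrite inE.
Qed.

(** By [root_share] rows under different roots share no column before [x], so a new root contributes
    an independent block. *)
Lemma cell_succ (f : 'I_n) u w : cell f.+1 u w =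
  if is_root f then
    exn u.+1 (fun u' => exn w.+1 (fun w' =>
      cell f (u - u') (w - w') && zero_block mo (descend x f) (cols (descend x f)) u' w'))
  else cell f u w.
Proof.
rewrite /cell prefix_succ; case: ifP => // rf.
have descendS : descend x f \subset S by case/andP: (rf) => /S_closed.
have sep (g g' : 'I_n) : g \in prefix f -> g' \in descend x f -> share x g g' = false.
  move=> /in_prefix[f' [ltf' rf' gf']] gf; apply/negP => /(root_share rf' rf gf' gf) ff.
  by move: ltf'; rewrite ff ltnn.
have out (c g : 'I_n) (A : {set 'I_n}) :
    (forall g', g' \in A -> share x g g' = false) -> c \in cols A -> ~~ mo g c.
  move=> nsh cA; apply/negP; rewrite /mo => mgc; have [g' g'A] := cols_share mgc cA.
  by rewrite nsh.
rewrite colsU setUA; apply: zero_block_union.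
- rewrite disjoint_subset; apply/subsetP => g gp; rewrite inE; apply/negP => gf.
  have [f' [ltf' rf' gf']] := in_prefix gp.
  by move: ltf'; rewrite (root_unique rf' rf gf' gf) ltnn.
- rewrite disjoint_subset; apply/subsetP => c; rewrite in_setU inE => cc; apply/negP => cf.
  move: (cf); rewrite inE => /andP[_ /existsP[g /andP[gf mgc]]].
  move: mgc; apply/negP; rewrite -/(mo g c).
  case/orP: cc => [cF|]; first by apply: F_free cF; apply: (subsetP descendS).
  by move=> cp; apply: (out c g (prefix f)); [move=> g' g'p; rewrite shareC sep | rewrite inE].
- by move=> g c gp cf; apply: out cf => g' g'f; rewrite sep.
- move=> g c gf; rewrite in_setU => /orP[cF|]; first by apply: F_free cF; apply: (subsetP descendS).
  by move=> cp; apply: out cp => g' g'p; rewrite shareC sep.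
Qed.

Lemma cell_all u w : cell n u w = zero_block mo S (F :|: cols S) u w.
Proof. by rewrite /cell prefix_all. Qed.

End Roots.

(* The index [f = n], which is not a row, stands for the set of all rows. *)
Definition piece x f : {set 'I_n} := if insub f is Some g then descend x g else setT.

(** The rows of a piece at level [x.+1] once column [x] is decided; [chosen] tells whether it is
    white. They split anew into components at level [x]. *)
Definition rest x f (chosen : bool) : {set 'I_n} :=
  [set g in piece x.+1 f | chosen ==> ~~ m g x].

(** Columns whose rows in the piece have all been excluded together with column [x]: they belong to
    no remaining component but may still be white. *)
Definition free_cols x f chosen := cols x (piece x.+1 f) :\: cols x (rest x f chosen).

(** [k] is the number of rows already examined as possible roots; [u] and [w] count black rows and
    white columns. *)
Definition table x f chosen k u w :=
  cell x (rest x f chosen) (free_cols x f chosen) k u w.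

Definition block x (f : 'I_n) u w := zero_block mo (descend x f) (cols x (descend x f)) u w.

Lemma piece_closed x f g : g \in piece x f -> descend x g \subset piece x f.
Proof.
rewrite /piece; case: insub => [h|_ ]; last by rewrite subsetT.
by move=> gh; apply/subsetP => a; apply: descend_trans.
Qed.

(** If a row below [g] met column [x], then so would [g], by [descend_col]. Hence excluding the rows
    of column [x] never cuts a descent of a remaining row. *)
Lemma rest_closed x f chosen g :
  g \in rest x f chosen -> descend x g \subset rest x f chosen.
Proof.
rewrite inE => /andP[gp gx]; apply/subsetP => a ag.
rewrite inE (subsetP (piece_closed gp)) ?descend_mono //=.
by case: chosen gx => //=; apply: contra; apply: descend_col ag _.
Qed.

Lemma cols_lt x A c : c \in cols x A -> c < x.
Proof. by rewrite inE => /andP[]. Qed.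

Lemma mem_cols x (A : {set 'I_n}) (g c : 'I_n) : g \in A -> m g c -> c < x -> c \in cols x A.
Proof. by move=> gA mgc ltc; rewrite inE ltc; apply/existsP; exists g; rewrite gA. Qed.

Lemma cols_sub x (A B : {set 'I_n}) : A \subset B -> cols x A \subset cols x B.
Proof.
move=> AB; apply/subsetP => c; rewrite !inE => /andP[-> /existsP[g /andP[gA mgc]]].
by apply/existsP; exists g; rewrite (subsetP AB).
Qed.

Lemma free_cols_free x f chosen :
  {in rest x f chosen & free_cols x f chosen, forall g c, ~~ mo g c}.
Proof.
move=> g c gr; rewrite inE => /andP[ncr /cols_lt ltc]; apply: contra ncr => mgc.
exact: mem_cols gr mgc ltc.
Qed.

Lemma table0 x f chosen u w :
  table x f chosen 0 u w = (u == 0) && (w <= #|free_cols x f chosen|).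
Proof. exact: cell0. Qed.

Lemma table_succ x f chosen (g : 'I_n) u w : table x f chosen g.+1 u w =
  if is_root x (rest x f chosen) g then
    exn u.+1 (fun u' => exn w.+1 (fun w' =>
      table x f chosen g (u - u') (w - w') && block x g u' w'))
  else table x f chosen g u w.
Proof. exact: cell_succ (@rest_closed x f chosen) _ (@free_cols_free x f chosen) _ _ _. Qed.

Lemma table_all x f chosen u w :
  table x f chosen n u w = zero_block mo (rest x f chosen) (cols x (piece x.+1 f)) u w.
Proof.
rewrite /table cell_all //; last exact: rest_closed.
congr (zero_block _ _ _ _ _); rewrite /free_cols setUC.
have sub : cols x (rest x f chosen) \subset cols x (piece x.+1 f).
  by apply: cols_sub; apply/subsetP => g; rewrite inE => /andP[].
by rewrite -{1}(setIidPr sub) setID.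
Qed.

Lemma block0 f u w : block 0 f u w = (w == 0) && (u <= 1).
Proof.
rewrite /block descend0 (_ : cols 0 _ = set0) ?zero_block_singleton //.
Qed.

(** By [descend_col] a row of the descent can meet column [x] only if its top [f] does, so [m f x]
    decides whether this column is available. *)
Lemma block_succ x f u w : x < n ->
  block x.+1 f u w = table x f false n u w || [&& m f x, 0 < w & table x f true n u w.-1].
Proof.
move=> ltx; rewrite !table_all /rest /piece valK /block.
rewrite (_ : [set g in _ | _] = descend x.+1 f); last by apply/setP => g; rewrite !inE andbT.
have colsE (A : {set 'I_n}) : cols x.+1 A =
    if [exists g : 'I_n, (g \in A) && m g x] then Ordinal ltx |: cols x A else cols x A.
  apply/setP => c; rewrite (fun_if (fun B : {set 'I_n} => c \in B)) !inE ltnS.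
  have [->|nc] := eqVneq c (Ordinal ltx); first by rewrite /= leqnn ltnn; case: ifP.
  have -> : (c <= x) = (c < x).
    rewrite leq_eqVlt (_ : (c == x :> nat) = false) //.
    by apply: contraNF nc => /eqP cx; apply/eqP/val_inj.
  by case: ifP.
rewrite colsE (_ : [exists g, _] = m f x); last first.
  apply/existsP/idP => [[g /andP[gf mgx]]|mfx]; last by exists f; rewrite descend_refl.
  exact: descend_col gf _ mgx.
case: ifP => _; rewrite ?orbF // (@zero_block_column _ _ mo _ _ (Ordinal ltx)) //.
by rewrite inE /= ltnn.
Qed.

Hypothesis col_nonempty : forall j, j < n -> exists i, m i j.

(** There is no column [n] to decide, and [col_nonempty] puts every column among those of the full
    set of rows. *)
Lemma table_top u w : table n n false n u w = zero_block mo [set: 'I_n] [set: 'I_n] u w.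
Proof.
rewrite table_all /rest /piece insubF ?ltnn //; congr zero_block.
  by apply/setP => g; rewrite !inE.
apply/setP => c; rewrite !inE ltn_ord; apply/existsP.
have [i mic] := col_nonempty (ltn_ord c); have [lti _] := m_lt mic.
by exists (Ordinal lti); rewrite inE.
Qed.

End Forest.

(** * Compiling arithmetic terms and filling arrays *)

(* Register 3 bounds every sum. *)
Inductive term :=
| TConst of nat
| TReg of nat
| TRead of nat & term
| TAdd of term & term
| TSub of term & term
| TIf of term & term & term
| TSum of nat & term.

Fixpoint teval (s : state) (t : term) : nat :=
  match t with
  | TConst k => k
  | TReg x => reg s x
  | TRead a t1 => arr s a (teval s t1)
  | TAdd t1 t2 => teval s t1 + teval s t2
  | TSub t1 t2 => teval s t1 - teval s t2
  | TIf t1 t2 t3 => if teval s t1 != 0 then teval s t2 else teval s t3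
  | TSum x t1 => \sum_(i < reg s 3) teval (set_reg s x i) t1
  end.

(* The value is computed in register [d], with scratch space above [d]; the
   bound variable of a sum is saved and restored. *)
Fixpoint compile (t : term) (d : nat) : cmd :=
  match t with
  | TConst k => Assign d (Const k)
  | TReg x => Assign d (Reg x)
  | TRead a t1 => Seq (compile t1 d) (Assign d (Read a (Reg d)))
  | TAdd t1 t2 => Seq (compile t1 d) (Seq (compile t2 d.+1)
                    (Assign d (Add (Reg d) (Reg d.+1))))
  | TSub t1 t2 => Seq (compile t1 d) (Seq (compile t2 d.+1)
                    (Assign d (Defs.Sub (Reg d) (Reg d.+1))))
  | TIf t1 t2 t3 => Seq (compile t1 d) (If (Reg d) (compile t2 d) (compile t3 d))
  | TSum x t1 =>
      Seq (Assign d.+1 (Reg x)) (Seq (Assign x (Const 0)) (Seq (Assign d (Const 0))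
        (Seq (While (Defs.Sub (Reg 3) (Reg x))
               (Seq (compile t1 d.+2)
                 (Seq (Assign d (Add (Reg d) (Reg d.+2)))
                      (Assign x (Add (Reg x) (Const 1))))))
             (Assign x (Reg d.+1)))))
  end.

(** Both branches of a conditional are charged, so the bound depends on the state only through [N].
    In a sum, 8 pays for the two assignments of the loop body and 4 for each test of the loop, the
    failing one included. *)
Fixpoint tcost (N : nat) (t : term) : nat :=
  match t with
  | TConst _ | TReg _ => 2
  | TRead _ t1 => tcost N t1 + 3
  | TAdd t1 t2 | TSub t1 t2 => tcost N t1 + (tcost N t2 + 4)
  | TIf t1 t2 t3 => tcost N t1 + (tcost N t2 + tcost N t3 + 2)
  | TSum _ t1 => 2 + (2 + (2 + ((N * (tcost N t1 + 8 + 4) + 4) + 2)))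
  end.

(** Bound variables lie above register 3, so that no loop changes the inputs or the range of the
    sums, and below the scratch space that starts at [d]. *)
Fixpoint twf (d : nat) (t : term) : bool :=
  match t with
  | TConst _ => true
  | TReg x => x < d
  | TRead _ t1 => twf d t1
  | TAdd t1 t2 | TSub t1 t2 => twf d t1 && twf d t2
  | TIf t1 t2 t3 => [&& twf d t1, twf d t2 & twf d t3]
  | TSum x t1 => [&& 3 < x, x < d & twf d t1]
  end.

Definition agree d (s s' : state) :=
  arr s' = arr s /\ forall y, y < d -> reg s' y = reg s y.

Definition run (c : cmd) (s : state) (k : nat) (s' : state) :=
  exists2 t, exec c s t s' & t <= k.

Lemma run_seq c1 c2 s1 s2 s3 k1 k2 :
  run c1 s1 k1 s2 -> run c2 s2 k2 s3 -> run (Seq c1 c2) s1 (k1 + k2) s3.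
Proof.
move=> [t1 e1 le1] [t2 e2 le2]; exists (t1 + t2); last exact: leq_add.
exact: ExecSeq e1 e2.
Qed.

Lemma run_assign s x f : run (Assign x f) s (expr_cost f).+1 (set_reg s x (eval s f)).
Proof. by exists (expr_cost f).+1 => //; apply: ExecAssign. Qed.

Lemma run_write s a f g : run (Write a f g) s (expr_cost f + expr_cost g).+1
  (set_arr s a (eval s f) (eval s g)).
Proof. by exists (expr_cost f + expr_cost g).+1 => //; apply: ExecWrite. Qed.

Lemma run_for x body N k (I : nat -> state -> Prop) s :
  (forall i s, I i s -> reg s 3 = N /\ reg s x = i) ->
  (forall i s, i < N -> I i s -> exists2 s', run body s k s' & I i.+1 s') ->
  I 0 s -> exists2 s', run (While (Defs.Sub (Reg 3) (Reg x)) body) s (N * (k + 4) + 4) s' & I N s'.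
Proof.
move=> IN Istep I0.
suff H r i s1 : i + r = N -> I i s1 ->
    exists2 s', run (While (Defs.Sub (Reg 3) (Reg x)) body) s1 (r * (k + 4) + 4) s' & I N s'.
  exact: (H N 0).
elim: r i s1 => [|r IHr] i s1 iN Ii; have [r3 rx] := IN _ _ Ii.
  rewrite addn0 in iN; exists s1; last by rewrite -iN.
  by exists 4 => //; apply: ExecWhileFalse; rewrite /= r3 rx iN subnn.
have lti : i < N by rewrite -iN addnS ltnS leq_addr.
have [s2 [t1 e1 le1] I2] := Istep _ _ lti Ii.
have [|s3 [t2 e2 le2] I3] := IHr i.+1 s2 _ I2; first by rewrite addSnnS.
exists s3 => //; exists (3 + t1 + t2).+1; last by clear -le1 le2; rewrite mulSn; lia.
by apply: ExecWhileTrue e1 e2; rewrite /= r3 rx subn_eq0 -ltnNge.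
Qed.

Lemma twf_leq d d' t : d <= d' -> twf d t -> twf d' t.
Proof.
move=> le; elim: t => //= [x|t1 IH1 t2 IH2|t1 IH1 t2 IH2|t1 IH1 t2 IH2 t3 IH3|x t IH].
- by move=> ltx; apply: leq_trans le.
- by case/andP => /IH1 -> /IH2.
- by case/andP => /IH1 -> /IH2.
- by case/and3P => /IH1 -> /IH2 -> /IH3.
- by case/and3P => -> ltx /IH ->; rewrite andbT; apply: leq_trans le.
Qed.

Lemma agree_trans d s1 s2 s3 : agree d s1 s2 -> agree d s2 s3 -> agree d s1 s3.
Proof. by move=> [a1 r1] [a2 r2]; split=> [|y lty]; rewrite ?a2 // r2 ?r1. Qed.

Lemma agree_leq d d' s s' : d <= d' -> agree d' s s' -> agree d s s'.
Proof. by move=> le [aa r]; split=> // y lty; apply: r; apply: leq_trans le. Qed.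

Lemma agree_set d s v : agree d s (set_reg s d v).
Proof. by split=> // y lty /=; rewrite ltn_eqF. Qed.

Lemma teval_agree d t s s' : 3 < d -> twf d t -> agree d s s' -> teval s' t = teval s t.
Proof.
move=> d3; elim: t s s' =>
  [//|x|a t IH|t1 IH1 t2 IH2|t1 IH1 t2 IH2|t1 IH1 t2 IH2 t3 IH3|x t IH] s s' /= wf ag.
- by case: ag => _; apply.
- by rewrite (IH s s') //; case: ag => ->.
- by case/andP: wf => wf1 wf2; rewrite (IH1 s s') // (IH2 s s').
- by case/andP: wf => wf1 wf2; rewrite (IH1 s s') // (IH2 s s').
- by case/and3P: wf => wf1 wf2 wf3; rewrite (IH1 s s') // (IH2 s s') // (IH3 s s').
- case/and3P: wf => _ ltx wf; case: ag => aE rE; rewrite rE //.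
  apply: eq_bigr => i _; apply: IH => //; split=> //= y lty.
  by case: eqP => // _; apply: rE.
Qed.

Lemma compile_ok t d s : twf d t -> 3 < d ->
  exists2 s', run (compile t d) s (tcost (reg s 3) t) s' &
    reg s' d = teval s t /\ agree d s s'.
Proof.
elim: t d s => [k|x|a t IH|t1 IH1 t2 IH2|t1 IH1 t2 IH2|t1 IH1 t2 IH2 t3 IH3|x t IH] d s /= wf d3.
- eexists; first exact: run_assign.
  by split; [rewrite /= eqxx | exact: agree_set].
- eexists; first exact: run_assign.
  by split; [rewrite /= eqxx | exact: agree_set].
- have [s1 r1 [v1 ag1]] := IH d s wf d3.
  eexists; first by apply: (run_seq r1); apply: run_assign.
  split; first by rewrite /= eqxx v1; case: ag1 => ->.
  exact: agree_trans ag1 (agree_set _ _ _).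
- case/andP: wf => wf1 wf2; have [s1 r1 [v1 ag1]] := IH1 d s wf1 d3.
  have [s2 r2 [v2 ag2]] := IH2 d.+1 s1 (twf_leq (leqnSn d) wf2) (ltnW d3).
  eexists.
    apply: (run_seq r1); rewrite -(proj2 ag1 3 d3); apply: (run_seq r2); apply: run_assign.
  split; last by apply: agree_trans (agree_set _ _ _); apply: agree_trans ag1 (agree_leq _ ag2).
  rewrite /= eqxx v2 (proj2 ag2) // v1; congr (_ + _).
  exact: teval_agree ag1.
- case/andP: wf => wf1 wf2; have [s1 r1 [v1 ag1]] := IH1 d s wf1 d3.
  have [s2 r2 [v2 ag2]] := IH2 d.+1 s1 (twf_leq (leqnSn d) wf2) (ltnW d3).
  eexists.
    apply: (run_seq r1); rewrite -(proj2 ag1 3 d3); apply: (run_seq r2); apply: run_assign.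
  split; last by apply: agree_trans (agree_set _ _ _); apply: agree_trans ag1 (agree_leq _ ag2).
  rewrite /= eqxx v2 (proj2 ag2) // v1; congr (_ - _).
  exact: teval_agree ag1.
- case/and3P: wf => wf1 wf2 wf3; have [s1 r1 [v1 ag1]] := IH1 d s wf1 d3.
  have r3 := proj2 ag1 3 d3.
  have [c0|c0] := boolP (teval s t1 != 0).
    have [s2 [k2 e2 le2] [v2 ag2]] := IH2 d s1 wf2 d3.
    exists s2; last by split; [rewrite v2; exact: teval_agree ag1 | exact: agree_trans ag1 ag2].
    apply: (run_seq r1); exists (1 + k2).+1.
      by apply: ExecIfTrue e2; rewrite /= v1.
    by rewrite r3 in le2; clear -le2; lia.
  have [s2 [k2 e2 le2] [v2 ag2]] := IH3 d s1 wf3 d3.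
  exists s2; last by split; [rewrite v2; exact: teval_agree ag1 | exact: agree_trans ag1 ag2].
  apply: (run_seq r1); exists (1 + k2).+1.
    by apply: ExecIfFalse e2; rewrite /= v1; apply: negbNE.
  by rewrite r3 in le2; clear -le2; lia.
- case/and3P: wf => x3 ltx wf.
  have nxd : (x == d) = false by rewrite ltn_eqF.
  have nxd1 : (x == d.+1) = false by rewrite ltn_eqF // ltnW.
  have nx3 : (3 == x) = false by rewrite ltn_eqF.
  have nd3 : (3 == d) = false by rewrite ltn_eqF.
  have nd13 : (3 == d.+1) = false by rewrite ltn_eqF // ltnW.
  (* Register [d] accumulates the sum and [d.+1] keeps the old value of [x], which is restored after
     the loop. *)
  pose I i s' := [/\ reg s' d = \sum_(j < i) teval (set_reg s x j) t,
    reg s' d.+1 = reg s x, reg s' x = i,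
    forall y, y < d -> y != x -> reg s' y = reg s y & arr s' = arr s].
  have agI i s1 : I i s1 -> agree d (set_reg s x i) s1.
    move=> [_ _ rx ry aE]; split=> //= y lty; case: eqP => [-> //|/eqP]; exact: ry.
  pose s0 := set_reg (set_reg (set_reg s d.+1 (reg s x)) x 0) d 0.
  have I0 : I 0 s0.
    rewrite /I /s0 /= big_ord0 !eqxx nxd (gtn_eqF (ltnSn d)) eq_sym nxd1.
    split=> // y lty /negPf ->.
    by rewrite (ltn_eqF lty) (ltn_eqF (ltnW lty : y < d.+1)).
  pose body := Seq (compile t d.+2) (Seq (Assign d (Add (Reg d) (Reg d.+2)))
    (Assign x (Add (Reg x) (Const 1)))).
  have IN i s1 : I i s1 -> reg s1 3 = reg s 3 /\ reg s1 x = i.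
    move=> II; by case: II => _ _ rx ry _; split=> //; apply: ry; rewrite ?nx3.
  have Istep i s1 : i < reg s 3 -> I i s1 ->
      exists2 s', run body s1 (tcost (reg s 3) t + (4 + 4)) s' & I i.+1 s'.
    move=> lti II; have [s2 r2 [v2 ag2]] := IH d.+2 s1 (twf_leq (leqW (leqnSn d)) wf) (leqW (leqW d3)).
    have r13 : reg s1 3 = reg s 3 by case: (II) => _ _ _ ry _; apply: ry; rewrite ?nx3.
    eexists.
      by rewrite -r13; apply: (run_seq r2); apply: run_seq; apply: run_assign.
    case: ag2 => aE2 rE2; case: (II) => rd rd1 rx ry aE.
    rewrite /I /= !eqxx nxd [d == x]eq_sym nxd [d.+1 == x]eq_sym nxd1 (gtn_eqF (ltnSn d)).
    split.
    * rewrite v2 rE2; last by clear; lia.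
      rewrite rd big_ord_recr /=; congr (_ + _).
      exact: teval_agree (agI _ _ II).
    * by rewrite rE2.
    * by rewrite rE2 ?rx ?addn1 // ltnW // ltnW.
    * move=> y lty nyx; rewrite (negPf nyx) (ltn_eqF lty) rE2 ?ry //.
      by rewrite ltnW // ltnW.
    * by rewrite aE2.
  have [s2 r2 [rd rd1 rx ry aE]] := run_for IN Istep I0.
  eexists.
    apply: run_seq; first exact: run_assign.
    apply: run_seq; first exact: run_assign.
    apply: run_seq; first exact: run_assign.
    rewrite -[tcost _ _ + 8]/(tcost _ _ + (4 + 4)).
    apply: run_seq; first exact: r2.
    exact: run_assign.
  split; first by rewrite /= eq_sym nxd rd.
  split=> //= y lty; case: eqP => [->|/eqP] //; exact: ry.
Qed.

(** * Arrays indexed by tuples, filled in lexicographic order *)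

Fixpoint index_of N (xs : seq nat) : nat :=
  if xs is x :: ys then x * N ^ size ys + index_of N ys else 0.

Lemma index_of_lt N xs : all (fun x => x < N) xs -> index_of N xs < N ^ size xs.
Proof.
elim: xs => //= x ys IH /andP[ltx /IH lt].
rewrite expnS; apply: (@leq_trans (x.+1 * N ^ size ys)); last by rewrite leq_mul2r ltx orbT.
by rewrite mulSn addnC ltn_add2r.
Qed.

Lemma index_of_rcons N xs x : index_of N (rcons xs x) = index_of N xs * N + x.
Proof.
elim: xs => [|y ys IH] /=; first by rewrite expn0 muln1 addn0.
by rewrite IH size_rcons mulnDl expnSr mulnA addnA.
Qed.

Lemma index_of_inj N xs ys : size xs = size ys ->
  all (fun x => x < N) xs -> all (fun x => x < N) ys ->
  index_of N xs = index_of N ys -> xs = ys.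
Proof.
elim: xs ys => [|x xs IH] [|y ys] //= [sz] /andP[ltx ax] /andP[lty ay].
have [lx ly] := (index_of_lt ax, index_of_lt ay); rewrite sz in lx *.
have N0 : 0 < N ^ size ys by apply: leq_ltn_trans lx.
move=> E; have xy : x = y.
  have := congr1 (divn^~ (N ^ size ys)) E.
  by rewrite !divnMDl // !divn_small ?addn0.
by rewrite xy in E *; congr cons; apply: IH => //; apply: addnI E.
Qed.

(** Base [N] digits are written with the most significant one first, so a smaller leading coordinate
    means an earlier cell. This shows that recursive reads hit cells already filled. *)
Lemma index_of_lex N x y xs ys : size xs = size ys -> x < y ->
  all (fun x => x < N) xs -> index_of N (x :: xs) < index_of N (y :: ys).
Proof.
move=> sz ltxy /index_of_lt lt /=; rewrite -sz.
apply: (@leq_trans (x.+1 * N ^ size xs)); first by rewrite mulSn addnC ltn_add2r.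
by apply: (@leq_trans (y * N ^ size xs)); rewrite ?leq_addr // leq_mul2r ltxy orbT.
Qed.

(** Bound occurrences count as reads too, but [x] may be the variable of a sum whose body does not
    read it; [tindex] is of this kind. *)
Fixpoint fresh (x : nat) (t : term) : bool :=
  match t with
  | TConst _ => true
  | TReg y => x != y
  | TRead _ t1 => fresh x t1
  | TAdd t1 t2 | TSub t1 t2 => fresh x t1 && fresh x t2
  | TIf t1 t2 t3 => [&& fresh x t1, fresh x t2 & fresh x t3]
  | TSum y t1 => fresh x t1
  end.

Lemma fresh_eval x t s s' : fresh x t -> x != 3 -> arr s' = arr s ->
  (forall y, y != x -> reg s' y = reg s y) -> teval s' t = teval s t.
Proof.
move=> + x3; elim: t s s' =>
  [//|y|a t IH|t1 IH1 t2 IH2|t1 IH1 t2 IH2|t1 IH1 t2 IH2 t3 IH3|y t IH] s s' /= wf aE rE.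
- by rewrite rE // eq_sym.
- by rewrite (IH s s') // aE.
- by case/andP: wf => wf1 wf2; rewrite (IH1 s s') // (IH2 s s').
- by case/andP: wf => wf1 wf2; rewrite (IH1 s s') // (IH2 s s').
- by case/and3P: wf => wf1 wf2 wf3; rewrite (IH1 s s') // (IH2 s s') // (IH3 s s').
- rewrite rE 1?eq_sym //; apply: eq_bigr => i _; apply: IH => //= z nz.
  by case: eqP => // _; apply: rE.
Qed.

(** Horner's rule. In place of a multiplication by [N], the sum adds [N] copies of the accumulator;
    register 19 is reserved as its dummy variable. *)
Definition tindex (ts : seq term) : term :=
  foldl (fun acc t => TAdd (TSum 19 acc) t) (TConst 0) ts.

Lemma tindex_rcons ts t : tindex (rcons ts t) = TAdd (TSum 19 (tindex ts)) t.
Proof. by rewrite /tindex -cats1 foldl_cat. Qed.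

Lemma fresh_tindex ts : all (fresh 19) ts -> fresh 19 (tindex ts).
Proof.
elim/last_ind: ts => // ts t IH; rewrite all_rcons tindex_rcons /= => /andP[-> /IH].
by rewrite andbT.
Qed.

Lemma teval_tindex s ts : all (fresh 19) ts ->
  teval s (tindex ts) = index_of (reg s 3) (map (teval s) ts).
Proof.
elim/last_ind: ts => // ts t IH; rewrite all_rcons => /andP[_ fts].
rewrite tindex_rcons map_rcons index_of_rcons -IH //=.
rewrite (eq_bigr (fun _ => teval s (tindex ts))); last first.
  move=> i _; apply: (@fresh_eval 19) => //; first exact: fresh_tindex.
  by move=> y /negPf /= ->.
by rewrite sum_nat_const card_ord mulnC.
Qed.

Fixpoint loops (j d : nat) (c : cmd) : cmd :=
  if d is d'.+1 then
    Seq (Assign j (Const 0)) (While (Defs.Sub (Reg 3) (Reg j))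
      (Seq (loops j.+1 d' c) (Assign j (Add (Reg j) (Const 1)))))
  else c.

Definition coords d : seq term := map TReg (iota 4 d).

(** The coordinates are in the registers from 4 on. The index waits in register 60 while the body is
    evaluated from register 61 on. *)
Definition fill (a d : nat) (body : term) : cmd :=
  loops 4 d (Seq (compile (tindex (coords d)) 60)
            (Seq (compile body 61) (Write a (Reg 60) (Reg 61)))).

Fixpoint loops_cost (N d k : nat) : nat :=
  if d is d'.+1 then 2 + (N * ((loops_cost N d' k + 4) + 4) + 4) else k.

Definition fill_cost (N d : nat) (body : term) : nat :=
  loops_cost N d (tcost N (tindex (coords d)) + (tcost N body + 3)).

Section Fill.
Variables (a d N : nat) (body : term) (s0 : state) (ok : seq nat -> nat -> Prop).

Definition grid_point (xs : seq nat) := (size xs == d) && all (fun x => x < N) xs.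

Definition frame (s : state) :=
  (forall y, y < 4 -> reg s y = reg s0 y) /\
  (forall a' i, a' != a -> arr s a' i = arr s0 a' i).

(** The loop invariant: correctness of the body may rely on all earlier cells of the array being
    filled, which is what a dynamic program needs. *)
Definition filled (k : nat) (s : state) :=
  forall xs, grid_point xs -> index_of N xs < k -> ok xs (arr s a (index_of N xs)).

Hypothesis d_le : d <= 6.
Hypothesis N_E : reg s0 3 = N.
Hypothesis body_wf : twf 60 body.
Hypothesis body_ok : forall s xs, frame s -> grid_point xs ->
  (forall i, i < d -> reg s (4 + i) = nth 0 xs i) ->
  filled (index_of N xs) s -> ok xs (teval s body).

Definition at_coords (xs : seq nat) (s : state) :=
  forall i, i < size xs -> reg s (4 + i) = nth 0 xs i.

Let cell_cmd := Seq (compile (tindex (coords d)) 60)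
  (Seq (compile body 61) (Write a (Reg 60) (Reg 61))).

Lemma map_coords s xs : size xs = d -> at_coords xs s -> map (teval s) (coords d) = xs.
Proof.
move=> sz xsE; apply: (@eq_from_nth _ 0); rewrite !size_map size_iota // => i lti.
rewrite (nth_map (TConst 0)) ?size_map ?size_iota //.
by rewrite (nth_map 0) ?size_iota //= nth_iota // xsE // sz.
Qed.

Lemma twf_coords : twf 60 (tindex (coords d)).
Proof.
suff H ts : all (twf 60) ts -> twf 60 (tindex ts).
  apply: H; rewrite all_map; apply/allP => x; rewrite mem_iota => /andP[_ ltx] /=.
  by apply: leq_trans ltx _; rewrite (leq_trans (_ : _ <= 4 + 6)) // leq_add2l.
by elim/last_ind: ts => // ts t IH; rewrite all_rcons tindex_rcons /= => /andP[-> /IH ->].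
Qed.

Lemma fresh_coords : all (fresh 19) (coords d).
Proof.
rewrite all_map; apply/allP => x; rewrite mem_iota => /andP[_ ltx] /=.
by rewrite gtn_eqF // (leq_trans ltx) // (leq_trans (_ : _ <= 4 + 6)) // leq_add2l.
Qed.

Lemma cell_ok xs s : grid_point xs -> at_coords xs s ->
  frame s -> filled (index_of N xs) s ->
  exists2 s', run cell_cmd s (tcost N (tindex (coords d)) + (tcost N body + 3)) s' &
    [/\ at_coords xs s', frame s' & filled (index_of N xs).+1 s'].
Proof.
move=> /andP[/eqP sz xsN] cxs fs fill_s.
have r3 : reg s 3 = N by rewrite -N_E; case: fs => fr _; apply: fr.
have [s1 r1 [v1 ag1]] := compile_ok s twf_coords (isT : 3 < 60).
have [s2 r2 [v2 ag2]] := compile_ok s1 (twf_leq (leqnSn 60) body_wf) (isT : 3 < 61).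
rewrite (teval_tindex _ fresh_coords) (map_coords sz cxs) r3 in v1.
have r13 : reg s1 3 = N by rewrite (proj2 ag1).
have vbody : teval s1 body = teval s body by apply: (@teval_agree 60).
have okb : ok xs (teval s body).
  by apply: body_ok => //; [rewrite /grid_point sz eqxx | move=> i lti; apply: cxs; rewrite sz].
have v60 : reg s2 60 = index_of N xs by rewrite (proj2 ag2) // v1.
have ag : agree 60 s s2 by apply: agree_trans ag1 (agree_leq _ ag2).
eexists.
  rewrite -[in tcost N (tindex _)]r3 -[in tcost N body]r13.
  by apply: (run_seq r1); apply: (run_seq r2); apply: run_write.
case: ag => aE rE; split.
- move=> i lti /=; rewrite rE ?cxs //.
  by rewrite sz in lti; rewrite (leq_trans (_ : _ <= 4 + 6)) // ltn_add2l (leq_trans lti).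
- case: fs => fr fa; split=> [y lty|a' i na] /=; first by rewrite rE ?fr // (leq_trans lty).
  by rewrite (negPf na) /= aE fa.
- move=> ys ys_t; rewrite ltnS leq_eqVlt => ltE /=.
  rewrite eqxx v60 v2 vbody aE /=; case: eqP ltE => [E _|_ /= lt]; last exact: fill_s.
  case/andP: ys_t => /eqP szy ysN.
  by rewrite (index_of_inj _ ysN xsN E) ?szy ?sz.
Qed.

Lemma loops_ok d' xs s : size xs + d' = d -> all (fun x => x < N) xs ->
  at_coords xs s -> frame s -> filled (index_of N xs * N ^ d') s ->
  exists2 s', run (loops (4 + size xs) d' cell_cmd) s
      (loops_cost N d' (tcost N (tindex (coords d)) + (tcost N body + 3))) s' &
    [/\ at_coords xs s', frame s' & filled ((index_of N xs).+1 * N ^ d') s'].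
Proof.
elim: d' xs s => [|d' IH] xs s szd xsN cxs fs fill_s.
  rewrite expn0 !muln1 in fill_s *; apply: cell_ok => //.
  by rewrite /grid_point -szd addn0 eqxx.
have lt6 : size xs < 6 by rewrite (leq_trans _ d_le) // -szd addnS ltnS leq_addr.
pose j := 4 + size xs.
pose I i s1 := [/\ reg s1 j = i, at_coords xs s1, frame s1 &
  filled ((index_of N xs * N + i) * N ^ d') s1].
pose s1 := set_reg s j 0.
have set_j s2 v : at_coords xs s2 -> frame s2 -> at_coords xs (set_reg s2 j v) /\ frame (set_reg s2 j v).
  move=> c2 [fr fa]; split.
    by move=> i lti /=; rewrite eqn_add2l ltn_eqF // c2.
  by split=> [y lty|//] /=; rewrite ltn_eqF ?fr // (leq_trans lty) // leq_addr.
have I0 : I 0 s1.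
  have [c1 f1] := set_j s 0 cxs fs; split=> //; first by rewrite /= eqxx.
  by rewrite addn0 -mulnA -expnS.
have IN i s2 : I i s2 -> reg s2 3 = N /\ reg s2 j = i.
  by case=> rj _ [fr _] _; split=> //; rewrite fr.
have Istep i s2 : i < N -> I i s2 -> exists2 s',
    run (Seq (loops j.+1 d' cell_cmd) (Assign j (Add (Reg j) (Const 1)))) s2
      (loops_cost N d' (tcost N (tindex (coords d)) + (tcost N body + 3)) + 4) s' & I i.+1 s'.
  move=> lti [rj c2 f2 fill2].
  have [||||s3 r3 [c3 f3 fill3]] := IH (rcons xs i) s2 _ _ _ f2 _.
  - by rewrite size_rcons addSn -addnS.
  - by rewrite all_rcons lti.
  - move=> i'; rewrite size_rcons ltnS leq_eqVlt nth_rcons => /predU1P[->|lt'].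
      by rewrite ltnn eqxx.
    by rewrite lt' c2.
  - by rewrite index_of_rcons.
  rewrite size_rcons addnS in r3.
  eexists; first by apply: (run_seq r3); apply: run_assign.
  have c3' : at_coords xs s3.
    by move=> i' lt'; have := c3 i'; rewrite size_rcons nth_rcons lt' => -> //; apply: leqW.
  have [c4 f4] := set_j s3 (eval s3 (Add (Reg j) (Const 1))) c3' f3; split=> //.
    have := c3 (size xs); rewrite size_rcons nth_rcons ltnn eqxx => /(_ (leqnn _)) rj3.
    by rewrite /= eqxx rj3 addn1.
  by rewrite addnS -index_of_rcons.
have [s2 r2 [_ c2 f2 fill2]] := run_for IN Istep I0.
exists s2; last by split=> //; move: fill2; rewrite -mulSnr expnS mulnA.
by rewrite /=; apply: run_seq r2; apply: run_assign.
Qed.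

Lemma fill_ok : exists2 s', run (fill a d body) s0 (fill_cost N d body) s' &
  frame s' /\ forall xs, grid_point xs -> ok xs (arr s' a (index_of N xs)).
Proof.
have c0 : at_coords [::] s0 by [].
have f0 : frame s0 by split.
have fill0 : filled (index_of N [::] * N ^ d) s0 by move=> xs _.
have [s1 r1 [_ f1 fill1]] := loops_ok (erefl d : size (Nil nat) + d = d) isT c0 f0 fill0.
exists s1; first exact: r1.
split=> // xs xs_t; apply: fill1 => //; rewrite mul1n.
by case/andP: xs_t => /eqP <- /index_of_lt.
Qed.

End Fill.

(** * Polynomial bounds for the costs *)

Definition poly_bounded (f : nat -> nat) := exists p : {poly nat}, forall n, f n <= p.[n]%R.

Lemma poly_bounded_const c : poly_bounded (fun=> c).
Proof. by exists (c%:P)%R => n; rewrite hornerC. Qed.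

Lemma poly_bounded_add f g : poly_bounded f -> poly_bounded g ->
  poly_bounded (fun n => f n + g n).
Proof.
by move=> [p pf] [q qg]; exists (p + q)%R => n; rewrite hornerD; apply: leq_add.
Qed.

Lemma poly_bounded_mul f g : poly_bounded f -> poly_bounded g ->
  poly_bounded (fun n => f n * g n).
Proof.
by move=> [p pf] [q qg]; exists (p * q)%R => n; rewrite hornerM; apply: leq_mul.
Qed.

Lemma poly_bounded_id : poly_bounded id.
Proof. by exists 'X%R => n; rewrite hornerX. Qed.

Lemma poly_bounded_tcost f t : poly_bounded f -> poly_bounded (fun n => tcost (f n) t).
Proof.
move=> pf; elim: t => [k|x|a t IH|t1 IH1 t2 IH2|t1 IH1 t2 IH2|t1 IH1 t2 IH2 t3 IH3|x t IH] /=;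
by repeat first [exact: poly_bounded_const | assumption
  | apply: poly_bounded_add | apply: poly_bounded_mul].
Qed.

Lemma poly_bounded_loops f k d : poly_bounded f -> poly_bounded k ->
  poly_bounded (fun n => loops_cost (f n) d (k n)).
Proof.
move=> pf pk; elim: d => //= d IH.
by repeat first [exact: poly_bounded_const | assumption
  | apply: poly_bounded_add | apply: poly_bounded_mul].
Qed.

Lemma poly_bounded_fill f d t : poly_bounded f -> poly_bounded (fun n => fill_cost (f n) d t).
Proof.
move=> pf; apply: poly_bounded_loops => //.
apply: poly_bounded_add; first exact: poly_bounded_tcost.
by apply: poly_bounded_add; [exact: poly_bounded_tcost | exact: poly_bounded_const].
Qed.

(** * The program *)

Definition holds s t := teval s t != 0.

Definition TBool t := TIf t (TConst 1) (TConst 0).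
Definition TNot t := TIf t (TConst 0) (TConst 1).
Definition TAnd t1 t2 := TIf t1 (TBool t2) (TConst 0).
Definition TOr t1 t2 := TIf t1 (TConst 1) (TBool t2).
Definition TLt t1 t2 := TBool (TSub t2 t1).
Definition TLe t1 t2 := TNot (TSub t1 t2).
Definition TEq t1 t2 := TAnd (TLe t1 t2) (TLe t2 t1).
Definition TEx x t := TBool (TSum x t).
(** Sums range below register 3, which exceeds [n] by two; the comparison with register 0 brings the
    range back to [n]. *)
Definition TExn x t := TEx x (TAnd (TLt (TReg x) (TReg 0)) t).
Definition TRd a ts := TRead a (tindex ts).

Lemma teval_sum s x t :
  teval s (TSum x t) = \sum_(i < reg s 3) teval (set_reg s x i) t.
Proof. by []. Qed.

Lemma teval_if s t1 t2 t3 :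
  teval s (TIf t1 t2 t3) = if holds s t1 then teval s t2 else teval s t3.
Proof. by []. Qed.

Lemma teval_bool s t : teval s (TBool t) = holds s t.
Proof. by rewrite /TBool /= /holds; case: eqP. Qed.

Lemma holds_bool s t : holds s (TBool t) = holds s t.
Proof. by rewrite {1}/holds teval_bool; case: holds. Qed.

Lemma teval_and s t1 t2 : teval s (TAnd t1 t2) = holds s t1 && holds s t2.
Proof. by rewrite /TAnd [LHS]/= -/(holds s t1) -/(holds s t2); do 2 case: holds. Qed.

Lemma teval_not s t : teval s (TNot t) = ~~ holds s t.
Proof. by rewrite /TNot [LHS]/= -/(holds s t); case: holds. Qed.

Lemma holds_and s t1 t2 : holds s (TAnd t1 t2) = holds s t1 && holds s t2.
Proof. by rewrite {1}/holds teval_and; do 2 case: holds. Qed.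

Lemma teval_or s t1 t2 : teval s (TOr t1 t2) = holds s t1 || holds s t2.
Proof. by rewrite /TOr [LHS]/= -/(holds s t1) -/(holds s t2); do 2 case: holds. Qed.

Lemma holds_or s t1 t2 : holds s (TOr t1 t2) = holds s t1 || holds s t2.
Proof. by rewrite {1}/holds teval_or; do 2 case: holds. Qed.

Lemma holds_not s t : holds s (TNot t) = ~~ holds s t.
Proof. by rewrite {1}/holds teval_not; case: holds. Qed.

Lemma holds_if s t1 t2 t3 :
  holds s (TIf t1 t2 t3) = if holds s t1 then holds s t2 else holds s t3.
Proof. by rewrite /holds /=; case: ifP. Qed.

Lemma holds_lt s t1 t2 : holds s (TLt t1 t2) = (teval s t1 < teval s t2).
Proof. by rewrite holds_bool /holds /= subn_eq0 -ltnNge. Qed.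

Lemma holds_le s t1 t2 : holds s (TLe t1 t2) = (teval s t1 <= teval s t2).
Proof. by rewrite holds_not /holds /= subn_eq0 negbK. Qed.

Lemma holds_eq s t1 t2 : holds s (TEq t1 t2) = (teval s t1 == teval s t2).
Proof. by rewrite holds_and !holds_le eqn_leq. Qed.

Lemma holds_ex s x t : holds s (TEx x t) = exn (reg s 3) (fun i => holds (set_reg s x i) t).
Proof.
rewrite holds_bool {1}/holds /= sum_nat_eq0; apply/idP/exnP.
  by rewrite negb_forall => /existsP[i /=]; exists i.
move=> [i lti hi]; apply/negP => /forallP/(_ (Ordinal lti)) /=.
by rewrite (negPf hi).
Qed.

Lemma holds_exn s x t : x != 0 -> reg s 0 <= reg s 3 ->
  holds s (TExn x t) = exn (reg s 0) (fun i => holds (set_reg s x i) t).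
Proof.
move=> x0 le; rewrite holds_ex; apply/exnP/exnP => -[i].
  rewrite holds_and holds_lt /= eqxx eq_sym (negPf x0) => _ /andP[lti hi].
  by exists i.
move=> lti hi; exists i; first exact: leq_trans le.
by rewrite holds_and hi andbT holds_lt /= eqxx eq_sym (negPf x0).
Qed.

Lemma teval_rd s a ts : all (fresh 19) ts ->
  teval s (TRd a ts) = arr s a (index_of (reg s 3) (map (teval s) ts)).
Proof. by move=> fts; rewrite -teval_tindex. Qed.

Lemma exn_narrow n x (P : pred nat) : (forall i, P i -> i < n) ->
  exn n (fun i => (i < x) && P i) = exn x P.
Proof.
move=> Pn; apply/exnP/exnP => -[i lti]; first by case/andP; exists i.
by move=> Pi; exists i; [exact: Pn | rewrite lti].
Qed.

Lemma exn_le N b (P : pred nat) : b < N ->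
  exn N (fun i => (i <= b) && P i) = exn b.+1 P.
Proof.
move=> ltb; apply/exnP/exnP => -[i lti]; first by case/andP; exists i.
by move=> Pi; exists i; [apply: leq_trans ltb | rewrite -ltnS lti].
Qed.

(** Terms have no local definitions; a quantifier over a value forced by an equation binds the
    predecessor of a register to a variable. *)
Lemma exn_singleton n k (P : pred nat) :
  exn n (fun i => (i.+1 == k.+1) && P i) = (k < n) && P k.
Proof.
apply/exnP/andP => [[i lti /andP[/eqP[<-] Pi]] //|[ltk Pk]].
by exists k; rewrite ?eqxx.
Qed.

Lemma sum_ltn N k : k <= N -> \sum_(v < N) (v < k) = k.
Proof.
move=> le; rewrite -(big_mkord xpredT (fun v => nat_of_bool (v < k))) (big_cat_nat (leq0n k) le) //=.
rewrite big_nat (eq_bigr (fun=> 1)) => [|i /andP[_ ->] //].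
rewrite -big_nat big_const_nat iter_addn_0 mul1n subn0.
rewrite big_nat big1 ?addn0 // => i /andP[lei _].
by rewrite ltnNge lei.
Qed.

(** The least element is the number of bounds [v] up to which [Q] is nowhere true, and so becomes a
    sum of truth values. *)
Lemma sum_least n N (Q : pred nat) : exn n Q -> n <= N ->
  \sum_(v < N) ~~ exn n (fun c => (c <= v) && Q c) = least n Q.
Proof.
move=> /exnP[c ltc Qc] leN; have [lt Ql] := least_lt ltc Qc.
rewrite -[RHS](@sum_ltn N); last exact: leq_trans (ltnW lt) leN.
apply: eq_bigr => v _; congr nat_of_bool; rewrite ltnNge; congr negb.
apply/exnP/idP => [[d ltd /andP[led Qd]]|le]; last by exists (least n Q); rewrite ?le.
apply: leq_trans led; rewrite leqNgt; apply/negP => ltdl.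
have := before_find 0 ltdl; rewrite nth_iota ?add0n ?Qd //.
Qed.

Lemma sum_card n N (Q : pred nat) : n <= N ->
  \sum_(c < N) ((c < n) && Q c) = #|[set c : 'I_n | Q c]|.
Proof.
move=> leN; rewrite -sum1_card -(big_mkord xpredT (fun c => nat_of_bool ((c < n) && Q c))).
rewrite (big_cat_nat (leq0n n) leN) //= [X in _ + X]big_nat [X in _ + X]big1 ?addn0; last first.
  by move=> i /andP[lei _]; rewrite ltnNge lei.
rewrite big_mkord [RHS]big_mkcond /=; apply: eq_bigr => c _.
by rewrite inE ltn_ord /=; case: (Q c).
Qed.

Notation "$ x" := (TReg x) (at level 2, format "$ x").

(* Array 1 holds the closed adjacency matrix, arrays 2 and 3 the greedy orders
   of the columns and of the rows, array 4 the sorted matrix, array 5 the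
   pieces and array 6 the table of the dynamic program. *)

(** The input has rows of length [n], unlike the arrays in base [n + 2]. The sum adds register 0
    once for each value below [$4], which is the product of the row index and [n]. *)
Definition adj_body : term :=
  TAnd (TLt $4 $0) (TAnd (TLt $5 $0) (TOr (TEq $4 $5)
    (TRead 0 (TAdd (TSum 20 (TIf (TLt $20 $4) $0 (TConst 0))) $5)))).

Definition TNew a r : term := TNot (TExn 26 (TAnd (TLt $26 $4) (TEq (TRd a [:: $26]) $r))).

Definition TLeast (t : term) : term :=
  TSum 20 (TNot (TExn 21 (TAnd (TLe $21 $20) t))).

Definition col_test : term :=
  TAnd (TNew 2 21) (TNot (TExn 22 (TExn 23 (TExn 24 (TExn 25
    (TAnd (TRd 1 [:: $22; $21]) (TAnd (TRd 1 [:: $23; $21])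
    (TAnd (TNew 2 24) (TAnd (TNew 2 25)
    (TAnd (TAnd (TRd 1 [:: $22; $24]) (TNot (TRd 1 [:: $23; $24])))
      (TAnd (TRd 1 [:: $23; $25]) (TNot (TRd 1 [:: $22; $25]))))))))))))).

Definition row_test : term :=
  TAnd (TNew 3 21) (TNot (TExn 22 (TExn 23 (TExn 24
    (TAnd (TNew 3 22) (TAnd (TLt $23 $24)
    (TAnd (TRd 1 [:: $21; TRd 2 [:: $23]]) (TAnd (TRd 1 [:: $21; TRd 2 [:: $24]])
    (TAnd (TRd 1 [:: $22; TRd 2 [:: $23]])
      (TNot (TRd 1 [:: $22; TRd 2 [:: $24]]))))))))))).

Definition sorted_body : term :=
  TAnd (TLt $4 $0) (TAnd (TLt $5 $0) (TRd 1 [:: TRd 3 [:: $4]; TRd 2 [:: $5]])).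

Definition TShare z x f g : term :=
  TExn z (TAnd (TLt $z $x) (TAnd (TRd 4 [:: $f; $z]) (TRd 4 [:: $g; $z]))).

(** The recursion [descendE] with [x], [f], [g] in registers 4, 5, 6; it reads cells with a smaller
    [f]. *)
Definition piece_body : term :=
  TOr (TEq $5 $0) (TOr (TEq $6 $5)
    (TExn 20 (TAnd (TAnd (TLt $20 $5) (TShare 21 4 5 20)) (TRd 5 [:: $4; $20; $6])))).

Definition TPiece g : term := TRd 5 [:: TAdd $4 (TConst 1); $5; $g].

Definition TRest g : term := TAnd (TPiece g) (TNot (TAnd $6 (TRd 4 [:: $g; $4]))).

Definition TRoot z h g : term :=
  TAnd (TRest g) (TNot (TExn h (TAnd (TRest h) (TAnd (TLt $g $h) (TShare z 4 g h))))).

Definition TFree : term :=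
  TSum 20 (TAnd (TLt $20 $0) (TAnd (TLt $20 $4)
    (TAnd (TNot (TExn 21 (TAnd (TRest 21) (TRd 4 [:: $21; $20]))))
          (TExn 21 (TAnd (TPiece 21) (TRd 4 [:: $21; $20])))))).

(** The recursion [block_succ], with [block0] when [$4] is 0. Here [y] is bound to the predecessor
    of [$4], and the constant coordinate 0 or 1 of a cell tells whether column [y] is white. *)
Definition TBlock y g u w : term :=
  TIf $4
    (TExn y (TAnd (TEq (TAdd $y (TConst 1)) $4)
       (TOr (TRd 6 [:: $y; $g; TConst 0; $0; $u; $w])
          (TAnd (TRd 4 [:: $g; $y]) (TAnd (TLt (TConst 0) $w)
             (TRd 6 [:: $y; $g; TConst 1; $0; $u; TSub $w (TConst 1)]))))))
    (TAnd (TEq $w (TConst 0)) (TLe $u (TConst 1))).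

(** Registers 4 to 9 hold [x], [f], [chosen], [k], [u], [w]; the two cases are [table_succ] and
    [table0]. Cells are read either at the preceding [k] or, inside a block, at the preceding
    [x]. *)
Definition table_body : term :=
  TBool (TIf $7
    (TExn 20 (TAnd (TEq (TAdd $20 (TConst 1)) $7)
      (TIf (TRoot 22 21 20)
        (TEx 22 (TAnd (TLe $22 $8) (TEx 23 (TAnd (TLe $23 $9)
          (TAnd (TRd 6 [:: $4; $5; $6; $20; TSub $8 $22; TSub $9 $23])
                (TBlock 24 20 22 23))))))
        (TRd 6 [:: $4; $5; $6; $20; $8; $9]))))
    (TAnd (TEq $8 (TConst 0)) (TLe $9 TFree))).

(** [b] and [w] are arbitrary, and beyond the range of a coordinate they would address an unrelated
    cell. Searching for them among the coordinates yields 0 in that case, in accordance with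
    [bw_colorable_le]. *)
Definition answer : term :=
  TBool (TEx 20 (TEx 21 (TAnd (TAnd (TEq $20 $1) (TEq $21 $2))
    (TRd 6 [:: $0; $0; TConst 0; $0; $20; $21])))).

(** Register 3 is [n + 2] because the table at [x <= n] consults pieces at [x.+1], so that
    coordinates reach [n + 1]. The boolean coordinate fits as well, even for [n = 0]. *)
Definition bw_program : cmd :=
  Seq (Assign 3 (Add (Reg 0) (Const 2)))
  (Seq (fill 1 2 adj_body)
  (Seq (fill 2 1 (TLeast col_test))
  (Seq (fill 3 1 (TLeast row_test))
  (Seq (fill 4 2 sorted_body)
  (Seq (fill 5 3 piece_body)
  (Seq (fill 6 6 table_body)
  (Seq (compile answer 60) (Assign 0 (Reg 60))))))))).

(** * Correctness of the terms of the program *)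

Section Program.
Variables (n : nat) (e : rel 'I_n).

Notation N := n.+2.
Notation E := (nat_adj e).
Notation m := (sorted_adj n E).

Definition std (s : state) := reg s 0 = n /\ reg s 3 = N.

Lemma std_set s x v : 3 < x -> std s -> std (set_reg s x v).
Proof. by move=> x3 [s0 s3]; split; rewrite /= ltn_eqF // (ltn_trans _ x3). Qed.

Lemma std_exn s x t : 3 < x -> std s ->
  holds s (TExn x t) = exn n (fun i => holds (set_reg s x i) t).
Proof.
move=> x3 [s0 s3]; rewrite holds_exn ?s0 ?s3 //; last by rewrite ltnW.
by rewrite gtn_eqF // (ltn_trans _ x3).
Qed.

Lemma std_rd s a ts xs : std s -> all (fresh 19) ts -> map (teval s) ts = xs ->
  teval s (TRd a ts) = arr s a (index_of N xs).
Proof. by move=> [_ s3] fts <-; rewrite teval_rd // s3. Qed.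

Definition adj_ok (xs : seq nat) (v : nat) := v = E (nth 0 xs 0) (nth 0 xs 1) :> nat.

Definition input_ok (s : state) :=
  forall i j : 'I_n, arr s 0 (i * n + j) = e i j.

Lemma bw_input_ok b w : input_ok (bw_input e b w).
Proof.
move=> i j /=; congr nat_of_bool; apply/existsP/idP; last first.
  by move=> eij; exists i; apply/existsP; exists j; rewrite eqxx.
case=> i' /existsP[j' /andP[/eqP ij eij]].
have n0 : 0 < n by apply: leq_ltn_trans (ltn_ord i).
have ii : i = i'.
  apply: val_inj; have := congr1 (divn^~ n) ij.
  by rewrite !divnMDl // !divn_small ?addn0.
by rewrite ii in ij *; rewrite (val_inj (addnI ij) : j = j').
Qed.

Lemma adj_body_ok s xs : std s -> input_ok s ->
  reg s 4 = nth 0 xs 0 -> reg s 5 = nth 0 xs 1 -> adj_ok xs (teval s adj_body).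
Proof.
move=> [s0 s3] inp; rewrite /adj_ok => <- <-.
rewrite teval_and holds_and holds_or holds_lt holds_lt holds_eq /= s0.
case: ltnP => [lti|le]; last first.
  by case Eij: (E _ _) => //; have [] := nat_adj_lt Eij; rewrite ltnNge le.
case: ltnP => [ltj|le]; last first.
  by case Eij: (E _ _) => //; have [_] := nat_adj_lt Eij; rewrite ltnNge le.
pose i := Ordinal lti; pose j := Ordinal ltj.
rewrite -[reg s 4]/(val i) -[reg s 5]/(val j) nat_adjE /closed_adj /=.
congr (nat_of_bool (_ || _)).
set t := TSum _ _.
rewrite -[holds s _]/(arr s 0 (teval s (TAdd t $5)) != 0).
have -> : teval s (TAdd t $5) = i * n + j.
  rewrite -[LHS]/(teval s t + reg s 5) /t teval_sum s3; congr (_ + _).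
  transitivity (\sum_(k < N) (k < i) * n).
    by apply: eq_bigr => k _; rewrite teval_if holds_lt /= s0; case: ifP; rewrite ?mul1n.
  by rewrite -big_distrl /= sum_ltn // ltnW // ltnW // ltnW.
by rewrite inp; case: (e i j).
Qed.

Lemma ltN i : i < n -> i < N.
Proof. by move=> lti; do 2 apply: ltnW. Qed.

Definition adj_at (s : state) :=
  forall i j, i < N -> j < N -> arr s 1 (index_of N [:: i; j]) = E i j.

Lemma holds_adj s r c t1 t2 : std s -> adj_at s -> fresh 19 t1 -> fresh 19 t2 ->
  teval s t1 = r -> teval s t2 = c -> r < n -> c < n ->
  holds s (TRd 1 [:: t1; t2]) = E r c.
Proof.
move=> ss hE f1 f2 e1 e2 ltr ltc; rewrite /holds (@std_rd s 1 _ [:: r; c]) //=; last by rewrite e1 e2.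
  by rewrite hE ?ltN //; case: (E r c).
by rewrite f1 f2.
Qed.

Definition picks_at a P k (s : state) :=
  forall j, j < k -> arr s a (index_of N [:: j]) = greedy_pick P n j.

Lemma holds_new s a r P : std s -> r != 19 -> r != 26 -> reg s 4 < n ->
  picks_at a P (reg s 4) s ->
  holds s (TNew a r) = (reg s r \notin greedy P n (reg s 4)).
Proof.
move=> ss r19 r26 lt4 pk; rewrite holds_not std_exn //; congr negb; rewrite greedyE.
apply/exnP/mapP => [[j ltj]|[j]].
  rewrite holds_and holds_lt /= => /andP[lt].
  rewrite holds_eq (@std_rd _ a _ [:: j]) //=.
  by rewrite pk // (negPf r26) => /eqP <-; exists j; rewrite ?mem_iota.
rewrite mem_iota add0n => /= ltj E4; exists j; first exact: ltn_trans lt4.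
rewrite holds_and holds_lt /= ltj holds_eq (@std_rd _ a _ [:: j]) //=.
by rewrite pk // (negPf r26) E4.
Qed.

Lemma teval_least s t Q : std s -> exn n Q ->
  (forall v c, c < n -> holds (set_reg (set_reg s 20 v) 21 c) t = Q c) ->
  teval s (TLeast t) = least n Q.
Proof.
move=> ss exQ tQ; rewrite teval_sum (proj2 ss) -(@sum_least n N) //; last by rewrite ltnW // ltnW.
apply: eq_bigr => v _; rewrite teval_not std_exn //.
congr (nat_of_bool (~~ _)); apply: eq_exn => c ltc.
by rewrite holds_and holds_le /= tQ.
Qed.

Lemma holds_col_test s : std s -> adj_at s -> reg s 4 < n ->
  picks_at 2 (nest_col n E) (reg s 4) s -> reg s 21 < n ->
  holds s col_test = nest_col n E (greedy (nest_col n E) n (reg s 4)) (reg s 21).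
Proof.
move=> ss hE lt4 pk lt21; rewrite holds_and (@holds_new _ _ _ (nest_col n E)) //.
rewrite holds_not /nest_col; congr (_ && ~~ _).
rewrite std_exn //; apply: eq_exn => r ltr.
rewrite std_exn //.
apply: eq_exn => r' ltr'; rewrite std_exn //.
apply: eq_exn => d ltd; rewrite std_exn //.
apply: eq_exn => d' ltd'; set s4 := set_reg _ 25 d'.
have ss4 : std s4 by [].
rewrite !holds_and !(@holds_new s4 2 _ (nest_col n E)) // !holds_not.
by rewrite (@holds_adj s4 r (reg s 21)) // (@holds_adj s4 r' (reg s 21)) //
  (@holds_adj s4 r d) // (@holds_adj s4 r' d) // (@holds_adj s4 r' d') // (@holds_adj s4 r d').
Qed.

Lemma teval_col s a t k : std s -> k < n -> teval s t = k -> fresh 19 t ->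
  picks_at a (nest_col n E) n s -> teval s (TRd a [:: t]) = col_order n E k.
Proof. by move=> ss ltk tk ft pk; rewrite (@std_rd s a _ [:: k]) ?pk //= ?ft ?tk. Qed.

Hypothesis col_lt : forall i, i < n -> col_order n E i < n.

Lemma holds_row_test s : std s -> adj_at s -> reg s 4 < n ->
  picks_at 2 (nest_col n E) n s ->
  picks_at 3 (low_row n E) (reg s 4) s -> reg s 21 < n ->
  holds s row_test = low_row n E (greedy (low_row n E) n (reg s 4)) (reg s 21).
Proof.
move=> ss hE lt4 pk2 pk lt21; rewrite holds_and (@holds_new _ _ _ (low_row n E)) //.
rewrite holds_not /low_row; congr (_ && ~~ _).
rewrite std_exn //; apply: eq_exn => r' ltr'.
rewrite std_exn //.
apply: eq_exn => j ltj; rewrite std_exn //.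
apply: eq_exn => j' ltj'; set s4 := set_reg _ 24 j'.
have ss4 : std s4 by [].
have ej := @teval_col s4 2 $23 j ss4 ltj erefl erefl pk2.
have ej' := @teval_col s4 2 $24 j' ss4 ltj' erefl erefl pk2.
rewrite !holds_and (@holds_new s4 3 _ (low_row n E)) // !holds_not holds_lt.
by rewrite (@holds_adj s4 (reg s 21) (col_order n E j)) ?col_lt //
  (@holds_adj s4 (reg s 21) (col_order n E j')) ?col_lt //
  (@holds_adj s4 r' (col_order n E j)) ?col_lt // (@holds_adj s4 r' (col_order n E j')) ?col_lt.
Qed.

Hypothesis row_lt : forall i, i < n -> row_order n E i < n.

Lemma sorted_body_ok s : std s -> adj_at s ->
  picks_at 2 (nest_col n E) n s -> picks_at 3 (low_row n E) n s ->
  teval s sorted_body = m (reg s 4) (reg s 5).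
Proof.
move=> ss hE pk2 pk3; rewrite teval_and holds_and !holds_lt /= (proj1 ss) /sorted_adj.
case: ltnP => // lt4; case: ltnP => // lt5 /=.
rewrite (@holds_adj s (row_order n E (reg s 4)) (col_order n E (reg s 5))) ?col_lt ?row_lt //.
  by rewrite (@std_rd s 3 _ [:: reg s 4]) ?pk3.
exact: teval_col.
Qed.

Definition sorted_at (s : state) :=
  forall i j, i < N -> j < N -> arr s 4 (index_of N [:: i; j]) = m i j.

Lemma holds_sorted s i j t1 t2 : std s -> sorted_at s -> fresh 19 t1 -> fresh 19 t2 ->
  teval s t1 = i -> teval s t2 = j -> i < N -> j < N ->
  holds s (TRd 4 [:: t1; t2]) = m i j.
Proof.
move=> ss hm f1 f2 e1 e2 lti ltj; rewrite /holds (@std_rd s 4 _ [:: i; j]) //=; last by rewrite e1 e2.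
  by rewrite hm //; case: (m i j).
by rewrite f1 f2.
Qed.

Lemma m_lt i j : m i j -> i < n /\ j < n.
Proof. by case/and3P. Qed.

Lemma holds_share s z x f g : std s -> sorted_at s -> 3 < z ->
  all (fun y => y != 19) [:: z; f; g] -> all (fun y => y != z) [:: x; f; g] ->
  reg s f < N -> reg s g < N ->
  holds s (TShare z x f g) = share m (reg s x) (reg s f) (reg s g).
Proof.
move=> ss hm z3 /and4P[z19 f19 g19 _] /and4P[xz fz gz _] ltf ltg.
rewrite std_exn // /share -[RHS](@exn_narrow n); last by move=> j /= /andP[/m_lt[]].
apply: eq_exn => j ltj; have ss1 : std (set_reg s z j) by apply: std_set.
have ltjN := ltN ltj.
rewrite !holds_and holds_lt /= eqxx (negPf xz).
by rewrite (@holds_sorted _ (reg s f) j) ?(@holds_sorted _ (reg s g) j) //=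
  ?eqxx ?(negPf fz) ?(negPf gz) // eq_sym.
Qed.

Hypothesis m_gamma : gamma_free m id id.

Lemma exn_ord (P : pred nat) : exn n P = [exists i : 'I_n, P i].
Proof.
apply/exnP/existsP => [[i lti Pi]|[i Pi]]; first by exists (Ordinal lti).
by exists i.
Qed.

Lemma piece_ord x (f : 'I_n) : piece n m x f = descend m x f.
Proof. by rewrite /piece valK. Qed.

Lemma piece_n x : piece n m x n = [set: 'I_n].
Proof. by rewrite /piece insubF ?ltnn. Qed.

Lemma piece_body_ok s (g : 'I_n) : std s -> sorted_at s ->
  reg s 4 < N -> reg s 5 <= n -> reg s 6 = g ->
  (forall h : 'I_n, h < reg s 5 ->
     arr s 5 (index_of N [:: reg s 4; val h; val g]) = (g \in piece n m (reg s 4) h)) ->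
  teval s piece_body = (g \in piece n m (reg s 4) (reg s 5)).
Proof.
move=> ss hm lt4 le5 r6 prev.
rewrite teval_or holds_or !holds_eq /= (proj1 ss).
case: eqVneq => [->|nf]; first by rewrite piece_n inE.
have ltf : reg s 5 < n by rewrite ltn_neqAle nf.
rewrite -[in RHS](_ : val (Ordinal ltf) = reg s 5) // piece_ord descendE r6.
congr nat_of_bool; rewrite -[val g == _]/(g == Ordinal ltf); apply: (congr1 (orb (g == Ordinal ltf))).
rewrite std_exn // exn_ord; apply: eq_existsb => h.
rewrite !holds_and holds_lt (@holds_share _ 21 4 5 20) //=; try by rewrite ?ltN.
rewrite /down /=; case: ltnP => //= lth.
congr andb; rewrite /holds (@std_rd _ 5 _ [:: reg s 4; val h; val g]) //; last by rewrite /= r6.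
by rewrite prev // piece_ord; case: (_ \in _).
Qed.

Definition pieces_at (s : state) := forall x f (g : 'I_n), x < N -> f <= n ->
  arr s 5 (index_of N [:: x; f; val g]) = (g \in piece n m x f).

Section Table.
Variables (x f : nat) (c : bool).
Hypothesis (le_x : x <= n) (le_f : f <= n).

Definition at_table (s : state) := [/\ std s, sorted_at s, pieces_at s &
  [/\ reg s 4 = x, reg s 5 = f & reg s 6 = c]].

Lemma holds_piece s r (g : 'I_n) : at_table s -> r != 19 -> reg s r = g ->
  holds s (TPiece r) = (g \in piece n m x.+1 f).
Proof.
move=> [ss _ hp [e4 e5 _]] r19 rg.
rewrite /holds (@std_rd _ 5 _ [:: x.+1; f; val g]) //; last by rewrite /= e4 e5 rg addn1.
  by rewrite hp //; case: (_ \in _).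
by rewrite /= eq_sym r19.
Qed.

Lemma holds_rest s r (g : 'I_n) : at_table s -> r != 19 -> reg s r = g ->
  holds s (TRest r) = (g \in rest n m x f c).
Proof.
move=> at_s r19 rg; rewrite holds_and (holds_piece at_s r19 rg) holds_not holds_and.
case: at_s => ss hm _ [e4 _ e6]; rewrite inE.
rewrite (@holds_sorted _ (val g) x) //=; first by rewrite /holds /= e6; case: (c).
- by rewrite eq_sym r19.
- by rewrite ltN.
- exact: leqW.
Qed.

Lemma holds_root s z h r (g : 'I_n) : at_table s -> reg s r = g ->
  3 < z -> 6 < h -> all (fun y => y != 19) [:: z; h; r] ->
  all (fun y => y != z) [:: 4; r; h] -> r != h ->
  holds s (TRoot z h r) = is_root m x (rest n m x f c) g.
Proof.
move=> at_s rg z3 h6 n19 nz nrh; have [z19 h19 r19] : [/\ z != 19, h != 19 & r != 19].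
  by case/and4P: n19.
have h3 : 3 < h by rewrite (leq_trans _ h6).
rewrite holds_and (holds_rest at_s r19 rg) holds_not /is_root; congr (_ && ~~ _).
have [ss _ _ _] := at_s.
rewrite std_exn // exn_ord; apply: eq_existsb => k.
have at_k : at_table (set_reg s h k).
  case: at_s => _ hm hp [e4 e5 e6]; split; [exact: std_set | exact: hm | exact: hp |].
  by split; rewrite /= ltn_eqF // (leq_trans _ h6).
have hk : reg (set_reg s h k) h = k by rewrite /= eqxx.
rewrite holds_and (holds_rest at_k h19 hk); congr (_ && _).
rewrite holds_and holds_lt /= eqxx (negPf nrh) rg; congr (_ && _).
case: (at_k) => ssk hmk _ [e4 _ _].
have rk : reg (set_reg s h k) r = g by rewrite /= (negPf nrh).
rewrite (@holds_share _ z 4 r h) //.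
- by rewrite e4 rk hk shareC.
- by rewrite /= z19 r19 h19.
- by rewrite rk ltN.
- by rewrite hk ltN.
Qed.

Lemma teval_free s : at_table s -> teval s TFree = #|free_cols n m x f c|.
Proof.
move=> at_s; case: (at_s) => ss hm hp [e4 e5 e6].
rewrite teval_sum (proj2 ss) -[RHS](_ : #|[set v : 'I_n | (v < x) &&
    (~~ [exists g : 'I_n, (g \in rest n m x f c) && m g v] &&
     [exists g : 'I_n, (g \in piece n m x.+1 f) && m g v])]| = _); last first.
  apply: eq_card => v; rewrite !inE; case: (v < x) => //=.
rewrite -(@sum_card n N (fun v => (v < x) &&
    (~~ [exists g : 'I_n, (g \in rest n m x f c) && m g v] &&
     [exists g : 'I_n, (g \in piece n m x.+1 f) && m g v]))); last by do 2 apply: ltnW.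
apply: eq_bigr => v _; rewrite teval_and holds_lt holds_and holds_lt holds_and holds_not /= (proj1 ss) e4.
have at_v : at_table (set_reg s 20 v) by [].
have ltv : v < N := ltn_ord v.
congr (nat_of_bool [&& _, _, ~~ _ & _]).
  rewrite std_exn // exn_ord; apply: eq_existsb => g; rewrite holds_and.
  rewrite (@holds_rest (set_reg (set_reg s 20 v) 21 g) 21 g) //.
  by rewrite (@holds_sorted _ (val g) v) //; apply: ltN (ltn_ord g).
rewrite std_exn // exn_ord; apply: eq_existsb => g; rewrite holds_and.
rewrite (@holds_piece (set_reg (set_reg s 20 v) 21 g) 21 g) //.
by rewrite (@holds_sorted _ (val g) v) //; apply: ltN (ltn_ord g).
Qed.

Lemma holds_block s y r u w (g : 'I_n) : at_table s -> reg s r = g -> 6 < y ->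
  all (fun z => z != 19) [:: y; r; u; w] -> all (fun z => z != y) [:: r; u; w] ->
  reg s u < N -> reg s w < N ->
  (forall y' (c' : bool) w', y' < x -> w' < N ->
     arr s 6 (index_of N [:: y'; val g; nat_of_bool c'; n; reg s u; w']) =
     table n m y' g c' n (reg s u) w') ->
  holds s (TBlock y r u w) = block m x g (reg s u) (reg s w).
Proof.
move=> [ss hm hp [e4 e5 e6]] rg y6 /and5P[y19 r19 u19 w19 _] /and4P[ry uy wy _] ltu ltw prev.
have y3 : 3 < y by rewrite (leq_trans _ y6).
have y4 : (4 == y) = false by rewrite ltn_eqF // (leq_trans _ y6).
have y0 : (0 == y) = false by rewrite ltn_eqF // (leq_trans _ y6).
rewrite holds_if {1}/holds /= e4.
move: (x) le_x prev e4 => [|x'] lex prev e4.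
  by rewrite /= block0 holds_and holds_eq holds_le.
rewrite [_ != 0]/= std_exn // (block_succ m_gamma) //.
pose P y' := table n m y' g false n (reg s u) (reg s w)
   || [&& m g y', 0 < reg s w & table n m y' g true n (reg s u) (reg s w).-1].
transitivity (exn n (fun y' => (y'.+1 == x'.+1) && P y')); last first.
  by rewrite exn_singleton (lex : x' < n).
apply: eq_exn => y' lty'; have ssy : std (set_reg s y y') by apply: std_set.
rewrite holds_and holds_eq /= eqxx y4 e4 addn1; case: eqP => // -[yE] /=.
rewrite holds_or !holds_and holds_lt /= [w == y](negPf wy).
have fr t1 t2 c' : fresh 19 t1 -> fresh 19 t2 ->
    all (fresh 19) [:: $y; $r; TConst c'; $0; t1; t2].
  by move=> /= -> ->; rewrite eq_sym y19 eq_sym r19.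
congr (_ || [&& _, _ & _]).
- rewrite /holds (@std_rd _ 6 _ [:: y'; val g; nat_of_bool false; n; reg s u; reg s w]) //.
  + by rewrite prev ?yE //; case: table.
  + by apply: fr; rewrite /= eq_sym.
  + by rewrite /= eqxx (negPf ry) (negPf uy) (negPf wy) y0 rg (proj1 ss).
- rewrite (@holds_sorted _ (val g) y') //= ?eqxx ?(negPf ry) ?ltN //; by rewrite eq_sym.
- rewrite /holds (@std_rd _ 6 _ [:: y'; val g; nat_of_bool true; n; reg s u; (reg s w).-1]) //.
  + rewrite prev ?yE //; first by case: table.
    by apply: leq_ltn_trans ltw; apply: leq_pred.
  + by apply: fr; rewrite /= ?andbT eq_sym.
  + by rewrite /= eqxx (negPf ry) (negPf uy) (negPf wy) y0 rg (proj1 ss) subn1.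
Qed.

Lemma table_body_ok s k : at_table s -> reg s 7 = k -> k <= n ->
  reg s 8 < N -> reg s 9 < N ->
  (forall x' f' (c' : bool) k' u w, x' <= n -> f' <= n -> k' <= n -> u < N -> w < N ->
     index_of N [:: x'; f'; nat_of_bool c'; k'; u; w] <
       index_of N [:: x; f; nat_of_bool c; k; reg s 8; reg s 9] ->
     arr s 6 (index_of N [:: x'; f'; nat_of_bool c'; k'; u; w]) =
     table n m x' f' c' k' u w) ->
  teval s table_body = table n m x f c k (reg s 8) (reg s 9).
Proof.
move=> at_s e7 lek lt8 lt9 prev; case: (at_s) => ss hm hp [e4 e5 e6].
have cN : nat_of_bool c < N by case: (c).
rewrite teval_bool; congr nat_of_bool; rewrite holds_if {1}/holds /= e7.
case: k => [|k] in e7 lek prev *.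
  by rewrite /= table0 holds_and holds_eq holds_le teval_free.
rewrite [_ != 0]/= std_exn // -[k]/(val (Ordinal lek)) (table_succ m_gamma).
set g := Ordinal lek.
pose T k' u w := table n m x f c k' u w.
pose P k' := if is_root m x (rest n m x f c) g then
    exn (reg s 8).+1 (fun u' => exn (reg s 9).+1 (fun w' =>
      T k' (reg s 8 - u') (reg s 9 - w') && block m x g u' w'))
  else T k' (reg s 8) (reg s 9).
transitivity (exn n (fun k' => (k'.+1 == k.+1) && P k')); last first.
  by rewrite exn_singleton (lek : k < n).
apply: eq_exn => k' ltk'; rewrite holds_and holds_eq /= e7 addn1.
case: eqP => // -[kE]; rewrite /= kE in ltk' *.
have at1 : at_table (set_reg s 20 k) by [].
(* The first three coordinates are unchanged and the fourth drops from [k.+1] to [k]. *)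
have less u w : u < N -> w < N ->
    index_of N [:: x; f; nat_of_bool c; k; u; w] <
    index_of N [:: x; f; nat_of_bool c; k.+1; reg s 8; reg s 9].
  move=> ltu ltw; rewrite [X in X < _]/= [X in _ < X]/= !ltn_add2l.
  by apply: (@index_of_lex N k k.+1 [:: u; w] [:: reg s 8; reg s 9]); rewrite //= ltu ltw.
rewrite /P /T holds_if (@holds_root _ 22 21 20 g) //; case: ifP => rg.
  rewrite holds_ex [reg _ 3](proj2 ss) -[RHS](@exn_le N) //.
  apply: eq_exn => u' ltu'; rewrite holds_and holds_le /=; case: leqP => //= leu.
  rewrite holds_ex [reg _ 3](proj2 ss) -[RHS](@exn_le N) //.
  apply: eq_exn => w' ltw'; rewrite holds_and holds_le /=; case: leqP => //= lew.
  rewrite holds_and; set s2 := set_reg _ 23 w'.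
  have at2 : at_table s2 by [].
  congr (_ && _).
    rewrite /holds (@std_rd s2 6 _ [:: x; f; nat_of_bool c; k; reg s 8 - u'; reg s 9 - w']) //.
      have lu : reg s 8 - u' < N by apply: leq_ltn_trans (leq_subr _ _) lt8.
      have lw : reg s 9 - w' < N by apply: leq_ltn_trans (leq_subr _ _) lt9.
      by rewrite prev ?less ?(ltnW lek) //; case: table.
    by rewrite /= e4 e5 e6.
  (* A block reads the table at some [y' < x], so already the leading coordinate drops, whatever the
     others are. *)
  rewrite (@holds_block s2 24 20 22 23 g) // => y' c' w1 lty ltw1.
  have lty' : y' <= n by apply: leq_trans (ltnW lty) le_x.
  apply: prev => //; first exact: ltnW (ltn_ord g).
  apply: index_of_lex => //; rewrite /= (ltN (ltn_ord g)) (ltu' : reg s2 22 < N) ltw1 !andbT /=.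
  by have := leq_b1 c'; clear; lia.
rewrite /holds (@std_rd _ 6 _ [:: x; f; nat_of_bool c; k; reg s 8; reg s 9]) //.
  by rewrite prev ?less ?(ltnW lek) //; case: table.
by rewrite /= e4 e5 e6.
Qed.

End Table.

End Program.

(** * From colorings to the sorted matrix, and the run of the program *)

Lemma bw_colorableE n (e : rel 'I_n) b w : bw_colorable e b w =
  zero_block (closed_adj e) [set: 'I_n] [set: 'I_n] b w.
Proof.
apply/existsP/zero_blockP => [[B /existsP[W /and3P[/andP[dBW nE] /eqP Bb /eqP Ww]]]|[B [W [_ _ Bb Ww Z]]]].
  exists B, W; split; rewrite ?subsetT // => x y xB yW; rewrite negb_or.
  rewrite (forall_inP (forall_inP nE x xB) y yW) andbT.
  by apply: contraTneq yW => <-; rewrite (disjointFr dBW xB).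
exists B; apply/existsP; exists W; rewrite Bb Ww !eqxx !andbT; apply/andP; split.
  rewrite disjoint_subset; apply/subsetP => x xB; rewrite inE; apply/negP => xW.
  by have := Z x x xB xW; rewrite /closed_adj eqxx.
apply/forall_inP => x xB; apply/forall_inP => y yW.
by have := Z x y xB yW; rewrite negb_or => /andP[].
Qed.

(** Rows and columns have separate relabelings, since the sorted matrix permutes them differently
    and is in general no longer symmetric. *)
Lemma zero_block_relabel (T : finType) (m m' : T -> T -> bool) (p q : T -> T) u w :
  injective p -> injective q -> (forall x y, m x y = m' (p x) (q y)) ->
  zero_block m [set: T] [set: T] u w = zero_block m' [set: T] [set: T] u w.
Proof.
move=> pinj qinj mE; apply/zero_blockP/zero_blockP => -[B [W [_ _ Bu Ww Z]]].
  exists (p @: B), (q @: W); rewrite !card_imset // !subsetT; split=> //.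
  by move=> _ _ /imsetP[x xB ->] /imsetP[y yW ->]; rewrite -mE Z.
exists (p @^-1: B), (q @^-1: W); rewrite !card_preimset // !subsetT; split=> //.
by move=> x y; rewrite !inE mE; apply: Z.
Qed.

Lemma sorted_zero_block n (e : rel 'I_n) (m : 'I_n -> 'I_n -> bool) (ro co : nat -> nat) u w :
  (forall i, i < n -> ro i < n) -> (forall i, i < n -> co i < n) ->
  (forall i j, i < n -> j < n -> ro i = ro j -> i = j) ->
  (forall i j, i < n -> j < n -> co i = co j -> i = j) ->
  (forall i j, m i j = nat_adj e (ro i) (co j)) ->
  zero_block m [set: 'I_n] [set: 'I_n] u w = bw_colorable e u w.
Proof.
move=> ro_lt co_lt ro_inj co_inj mE; rewrite bw_colorableE.
pose f (o : nat -> nat) (o_lt : forall i, i < n -> o i < n) (i : 'I_n) :=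
  Ordinal (o_lt i (ltn_ord i)).
have f_inj o o_lt : (forall i j, i < n -> j < n -> o i = o j -> i = j) -> injective (@f o o_lt).
  by move=> o_inj i j /(congr1 val) /= /o_inj ij; apply/val_inj/ij.
apply: (zero_block_relabel _ _ (f_inj _ ro_lt ro_inj) (f_inj _ co_lt co_inj)) => i j.
by rewrite mE -nat_adjE.
Qed.

Section Assembly.
Variables (n : nat) (e : rel 'I_n) (b w : nat).

Notation N := n.+2.
Notation E := (nat_adj e).
Notation m := (sorted_adj n E).
Notation nest := (nest_col n E).
Notation low := (low_row n E).

Hypothesis nest_ex : forall l, uniq l -> all (fun c => c < n) l -> size l < n ->
  exists2 c, c < n & nest l c.
Hypothesis low_ex : forall l, uniq l -> all (fun c => c < n) l -> size l < n ->
  exists2 c, c < n & low l c.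
Hypothesis m_gamma : gamma_free m id id.

Let co_lt i : i < n -> col_order n E i < n.
Proof. by move=> /(greedy_pickP (@nest_col_new _ _) nest_ex)[]. Qed.

Let ro_lt i : i < n -> row_order n E i < n.
Proof. by move=> /(greedy_pickP (@low_row_new _ _) low_ex)[]. Qed.

Definition base (s : state) := [/\ std n s, reg s 1 = b & reg s 2 = w].

Lemma frame_base a s0 s : frame a s0 s -> base s0 -> base s.
Proof. by move=> [fr _] [[e0 e3] e1 e2]; split; [split|..]; rewrite fr. Qed.

Lemma frame_adj a s0 s : 1 != a -> frame a s0 s -> adj_at e s0 -> adj_at e s.
Proof. by move=> na [_ fa] h i j lti ltj; rewrite fa // h. Qed.

Lemma frame_picks a' P k a s0 s : a' != a -> frame a s0 s ->
  picks_at n a' P k s0 -> picks_at n a' P k s.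
Proof. by move=> na [_ fa] h j ltj; rewrite fa // h. Qed.

Lemma frame_sorted a s0 s : 4 != a -> frame a s0 s -> sorted_at e s0 -> sorted_at e s.
Proof. by move=> na [_ fa] h i j lti ltj; rewrite fa // h. Qed.

Lemma frame_pieces a s0 s : 5 != a -> frame a s0 s -> pieces_at e s0 -> pieces_at e s.
Proof. by move=> na [_ fa] h x f g ltx lef; rewrite fa // h. Qed.

Lemma base_N s : base s -> reg s 3 = N.
Proof. by case=> -[]. Qed.

Lemma run_adj s0 : base s0 -> input_ok e s0 ->
  exists2 s, run (fill 1 2 adj_body) s0 (fill_cost N 2 adj_body) s &
    base s /\ adj_at e s.
Proof.
move=> b0 inp.
have body_ok s xs : frame 1 s0 s -> grid_point 2 N xs ->
    (forall i, i < 2 -> reg s (4 + i) = nth 0 xs i) ->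
    filled 1 2 N (adj_ok e) (index_of N xs) s -> adj_ok e xs (teval s adj_body).
  move=> fs _ xsE _; apply: adj_body_ok; last exact: (xsE 1 isT).
  - by case: (frame_base fs b0).
  - by move=> i j; rewrite (proj2 fs).
  - exact: (xsE 0 isT).
have [s r [fs sE]] := fill_ok (d := 2) (isT : 2 <= 6) (base_N b0) (isT : twf 60 adj_body) body_ok.
exists s => //; split; first exact: frame_base fs b0.
by move=> i j lti ltj; rewrite (sE [:: i; j]) // /grid_point /= lti ltj.
Qed.

Lemma run_greedy s0 a (P : seq nat -> pred nat) t : base s0 -> twf 60 (TLeast t) ->
  (forall l c, P l c -> c \notin l) ->
  (forall l, uniq l -> all (fun c => c < n) l -> size l < n -> exists2 c, c < n & P l c) ->
  (forall s, frame a s0 s -> reg s 4 < n -> picks_at n a P (reg s 4) s ->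
    forall v c, c < n -> holds (set_reg (set_reg s 20 v) 21 c) t = P (greedy P n (reg s 4)) c) ->
  exists2 s, run (fill a 1 (TLeast t)) s0 (fill_cost N 1 (TLeast t)) s &
    frame a s0 s /\ picks_at n a P n s.
Proof.
move=> b0 wf P_new P_ex tP.
(* The loop also fills the cells [n] and [n.+1], which receive no specification. *)
pose ok xs (v : nat) := nth 0 xs 0 < n -> v = greedy_pick P n (nth 0 xs 0).
have body_ok s xs : frame a s0 s -> grid_point 1 N xs ->
    (forall i, i < 1 -> reg s (4 + i) = nth 0 xs i) ->
    filled a 1 N ok (index_of N xs) s -> ok xs (teval s (TLeast t)).
  case: xs => [|i []] // fs /andP[_ /andP[lti _]] xsE fil; rewrite /ok [nth _ _ _]/= => ltin.
  have e4 : reg s 4 = i := xsE 0 isT.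
  have pk : picks_at n a P (reg s 4) s.
    move=> j; rewrite e4 => ltj; apply: (fil [:: j]).
    - by rewrite /grid_point /= (ltn_trans ltj lti).
    - exact: (@index_of_lex N j i [::] [::]).
    - exact: ltn_trans ltin.
  have [ltp Pp] := greedy_pickP P_new P_ex ltin.
  rewrite (@teval_least n s t (P (greedy P n i))) //.
  - by case: (frame_base fs b0).
  - by apply/exnP; exists (greedy_pick P n i).
  - have lt4 : reg s 4 < n by rewrite e4.
    by move=> v c ltc; rewrite (tP s fs lt4 pk v c ltc) e4.
have [s r [fs sE]] := fill_ok (d := 1) (isT : 1 <= 6) (base_N b0) wf body_ok.
exists s => //; split=> // j ltj; apply: (sE [:: j]) => //.
by rewrite /grid_point /= ltN.
Qed.

Lemma run_sorted s0 : base s0 -> adj_at e s0 ->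
  picks_at n 2 nest n s0 -> picks_at n 3 low n s0 ->
  exists2 s, run (fill 4 2 sorted_body) s0 (fill_cost N 2 sorted_body) s &
    base s /\ sorted_at e s.
Proof.
move=> b0 ha h2 h3.
pose ok xs (v : nat) := v = m (nth 0 xs 0) (nth 0 xs 1) :> nat.
have body_ok s xs : frame 4 s0 s -> grid_point 2 N xs ->
    (forall i, i < 2 -> reg s (4 + i) = nth 0 xs i) ->
    filled 4 2 N ok (index_of N xs) s -> ok xs (teval s sorted_body).
  move=> fs _ xsE _; rewrite /ok -(xsE 0 isT) -(xsE 1 isT).
  apply: (sorted_body_ok co_lt ro_lt); first by case: (frame_base fs b0).
  - exact: frame_adj fs ha.
  - exact: frame_picks fs h2.
  - exact: frame_picks fs h3.
have [s r [fs sE]] := fill_ok (d := 2) (isT : 2 <= 6) (base_N b0) (isT : twf 60 sorted_body) body_ok.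
exists s => //; split; first exact: frame_base fs b0.
by move=> i j lti ltj; rewrite (sE [:: i; j]) // /grid_point /= lti ltj.
Qed.

Lemma run_pieces s0 : base s0 -> sorted_at e s0 ->
  exists2 s, run (fill 5 3 piece_body) s0 (fill_cost N 3 piece_body) s &
    [/\ base s, sorted_at e s & pieces_at e s].
Proof.
move=> b0 hm.
pose ok xs (v : nat) := forall g : 'I_n, nth 0 xs 2 = g -> nth 0 xs 1 <= n ->
  v = (g \in piece n m (nth 0 xs 0) (nth 0 xs 1)).
have body_ok s xs : frame 5 s0 s -> grid_point 3 N xs ->
    (forall i, i < 3 -> reg s (4 + i) = nth 0 xs i) ->
    filled 5 3 N ok (index_of N xs) s -> ok xs (teval s piece_body).
  case: xs => [|x [|f [|g' []]]] // fs /andP[_ /and4P[ltx ltf ltg _]] xsE fil g /= gE lef.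
  have e4 : reg s 4 = x := xsE 0 isT.
  have e5 : reg s 5 = f := xsE 1 isT.
  have e6 : reg s 6 = g by rewrite (xsE 2 isT : reg s 6 = g') gE.
  rewrite -e4 -e5; apply: piece_body_ok => //; rewrite ?e4 ?e5 //.
  - by case: (frame_base fs b0).
  - exact: frame_sorted fs hm.
  - move=> h lth; apply: (fil [:: x; val h; val g]) => //.
    + by rewrite /grid_point /= ltx !ltN // ltn_ord.
    + rewrite gE /= ltn_add2l.
      by apply: (@index_of_lex N (val h) f [:: val g] [:: val g]); rewrite //= ltN ?ltn_ord.
    + exact: ltnW (ltn_ord h).
have [s r [fs sE]] := fill_ok (d := 3) (isT : 3 <= 6) (base_N b0) (isT : twf 60 piece_body) body_ok.
exists s => //; split; first exact: frame_base fs b0.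
  exact: frame_sorted fs hm.
move=> x f g ltx lef; apply: (sE [:: x; f; val g]) => //.
by rewrite /grid_point /= ltx ltnS leqW //= ltN ?ltn_ord.
Qed.

Definition table_at (s : state) := forall x f (c : bool) k u v,
  x <= n -> f <= n -> k <= n -> u < N -> v < N ->
  arr s 6 (index_of N [:: x; f; nat_of_bool c; k; u; v]) = table n m x f c k u v.

Lemma run_table s0 : base s0 -> sorted_at e s0 -> pieces_at e s0 ->
  exists2 s, run (fill 6 6 table_body) s0 (fill_cost N 6 table_body) s &
    base s /\ table_at s.
Proof.
move=> b0 hm hp.
(* The specification covers only the cells whose third coordinate is a truth value and whose [x],
   [f] and [k] are at most [n]. *)
pose ok xs (v : nat) := forall c : bool, nth 0 xs 2 = c -> nth 0 xs 0 <= n -> nth 0 xs 1 <= n ->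
  nth 0 xs 3 <= n ->
  v = table n m (nth 0 xs 0) (nth 0 xs 1) c (nth 0 xs 3) (nth 0 xs 4) (nth 0 xs 5) :> nat.
have grid x f (c : bool) k u v : x <= n -> f <= n -> k <= n -> u < N -> v < N ->
    grid_point 6 N [:: x; f; nat_of_bool c; k; u; v].
  move=> lex lef lek ltu ltv; rewrite /grid_point /= ltu ltv.
  rewrite (leqW lex : x < N) (leqW lef : f < N) (leqW lek : k < N) !andbT /=.
  by case: (c).
have body_ok s xs : frame 6 s0 s -> grid_point 6 N xs ->
    (forall i, i < 6 -> reg s (4 + i) = nth 0 xs i) ->
    filled 6 6 N ok (index_of N xs) s -> ok xs (teval s table_body).
  case: xs => [|x [|f [|c' [|k [|u [|v []]]]]]] // fs.
  move=> /andP[_ /and5P[_ _ _ _ /and3P[ltu ltv _]]] xsE fil c /= cE lex lef lek.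
  have e4 : reg s 4 = x := xsE 0 isT.
  have e5 : reg s 5 = f := xsE 1 isT.
  have e6 : reg s 6 = c by rewrite (xsE 2 isT : reg s 6 = c') cE.
  have e7 : reg s 7 = k := xsE 3 isT.
  have e8 : reg s 8 = u := xsE 4 isT.
  have e9 : reg s 9 = v := xsE 5 isT.
  rewrite -e8 -e9; apply: (table_body_ok m_gamma lex lef); rewrite ?e8 ?e9 //.
    split; [by case: (frame_base fs b0) | exact: frame_sorted fs hm | exact: frame_pieces fs hp | by []].
  move=> x' f' d k' u' v' lex' lef' lek' ltu' ltv' lti.
  apply: (fil [:: x'; f'; nat_of_bool d; k'; u'; v']) => //; first exact: grid.
  by rewrite cE.
have [s r [fs sE]] := fill_ok (d := 6) (isT : 6 <= 6) (base_N b0) (isT : twf 60 table_body) body_ok.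
exists s => //; split; first exact: frame_base fs b0.
move=> x f c k u v lex lef lek ltu ltv.
by apply: (sE [:: x; f; nat_of_bool c; k; u; v]) => //; apply: grid.
Qed.

Lemma table_answer u v : table n m n n false n u v = bw_colorable e u v.
Proof.
have ro_inj := @greedy_pick_inj _ n (@low_row_new n E) low_ex.
have co_inj := @greedy_pick_inj _ n (@nest_col_new n E) nest_ex.
rewrite table_top //; first last.
(* Every column has a one: the row that stands for the same vertex meets it on the diagonal of the
   closed neighborhood matrix. *)
- move=> j ltj; pose f (i : 'I_n) := Ordinal (ro_lt (ltn_ord i)).
  have f_inj : injective f by move=> i i' /(congr1 val) /ro_inj ii; apply/val_inj/ii.
  pose c := Ordinal (co_lt ltj); exists (invF f_inj c).
  rewrite /sorted_adj ltj ltn_ord -[row_order _ _ _]/(val (f (invF f_inj c))) f_invF.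
  by rewrite -[col_order n E j]/(val c) nat_adjE /closed_adj eqxx.
- by move=> i j /and3P[].
apply: (sorted_zero_block _ _ ro_lt co_lt ro_inj co_inj) => i j.
by rewrite /mo /sorted_adj !ltn_ord.
Qed.

Lemma bw_colorable_le u v : bw_colorable e u v -> u <= n /\ v <= n.
Proof.
move=> /existsP[B /existsP[W /and3P[_ /eqP <- /eqP <-]]].
by rewrite -[X in _ <= X /\ _ <= X]card_ord !max_card.
Qed.

Lemma teval_answer s : base s -> table_at s -> teval s answer = bw_colorable e b w.
Proof.
move=> [ss e1 e2] ht; rewrite teval_bool; congr nat_of_bool.
have cell u v : u < N -> v < N ->
    holds (set_reg (set_reg s 20 u) 21 v)
      (TRd 6 [:: $0; $0; TConst 0; $0; $20; $21]) = bw_colorable e u v.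
  move=> ltu ltv; rewrite /holds (@std_rd n _ 6 _ [:: n; n; nat_of_bool false; n; u; v]) //.
    by rewrite ht // table_answer; case: bw_colorable.
  by rewrite /= (proj1 ss).
rewrite holds_ex (proj2 ss); apply/exnP/idP => [[u ltu]|bw].
  rewrite holds_ex [reg _ 3](proj2 ss) => /exnP[v ltv].
  by rewrite holds_and cell // holds_and !holds_eq /= e1 e2 => /andP[/andP[/eqP -> /eqP ->]].
have [leb lew] := bw_colorable_le bw.
have [ltb ltw] : b < N /\ w < N by split; apply: leqW.
exists b => //; rewrite holds_ex [reg _ 3](proj2 ss); apply/exnP; exists w => //.
by rewrite holds_and (cell _ _ ltb ltw) bw holds_and !holds_eq /= e1 e2 !eqxx.
Qed.

Definition program_cost k :=
  4 + (fill_cost k 2 adj_body + (fill_cost k 1 (TLeast col_test) +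
  (fill_cost k 1 (TLeast row_test) + (fill_cost k 2 sorted_body +
  (fill_cost k 3 piece_body + (fill_cost k 6 table_body + (tcost k answer + 2))))))).

Lemma bw_program_ok : exists2 s, run bw_program (bw_input e b w) (program_cost N) s &
  output s = bw_colorable e b w.
Proof.
pose s0 := set_reg (bw_input e b w) 3 (n + 2).
have b0 : base s0 by split; [split; rewrite //= addn2 | |].
have inp0 : input_ok e s0 by apply: bw_input_ok.
have [s1 r1 [b1 h1]] := run_adj b0 inp0.
have [||||s2 r2 [f2 h2]] := @run_greedy s1 2 nest col_test b1.
- by [].
- exact: nest_col_new.
- exact: nest_ex.
- move=> s fs lt4 pk v c ltc.
  rewrite (@holds_col_test n e (set_reg (set_reg s 20 v) 21 c)) //.
    by case: (frame_base fs b1).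
  exact: frame_adj fs h1.
have [b2 h1'] := (frame_base f2 b1, frame_adj (isT : 1 != 2) f2 h1).
have [||||s3 r3 [f3 h3]] := @run_greedy s2 3 low row_test b2.
- by [].
- exact: low_row_new.
- exact: low_ex.
- move=> s fs lt4 pk v c ltc.
  rewrite (@holds_row_test n e co_lt (set_reg (set_reg s 20 v) 21 c)) //.
  + by case: (frame_base fs b2).
  + exact: frame_adj fs h1'.
  + exact: frame_picks fs h2.
have b3 := frame_base f3 b2.
have [s4 r4 [b4 h4]] := run_sorted b3 (frame_adj (isT : 1 != 3) f3 h1')
  (frame_picks (isT : 2 != 3) f3 h2) h3.
have [s5 r5 [b5 h4' h5]] := run_pieces b4 h4.
have [s6 r6 [b6 h6]] := run_table b5 h4' h5.
have [s7 r7 [v7 _]] := @compile_ok answer 60 s6 isT isT.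
exists (set_reg s7 0 (teval s6 answer)); last exact: teval_answer b6 h6.
rewrite (base_N b6) in r7.
apply: run_seq; first exact: run_assign.
apply: (run_seq r1); apply: (run_seq r2); apply: (run_seq r3); apply: (run_seq r4).
apply: (run_seq r5); apply: (run_seq r6); apply: (run_seq r7).
by rewrite -v7; apply: run_assign.
Qed.

End Assembly.

Lemma poly_bounded_program : poly_bounded (fun n => program_cost n.+2).
Proof.
have pN : poly_bounded (fun n => n.+2).
  by have := poly_bounded_add poly_bounded_id (poly_bounded_const 2);
     case=> p pP; exists p => n; rewrite -addn2.
by repeat first [exact: poly_bounded_const | exact: poly_bounded_fill
  | exact: poly_bounded_tcost | apply: poly_bounded_add].
Qed.

Theorem theorem10 :
  exists (P : cmd) (p : {poly nat}),
    forall (n : nat) (e : rel 'I_n),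
      simple_graph e -> strongly_chordal e ->
      forall b w : nat,
      exists (t : nat) (s : state),
        [/\ exec P (bw_input e b w) t s,
            t <= p.[n]%R &
            output s = bw_colorable e b w].
Proof.
have [p pP] := poly_bounded_program; exists bw_program, p => n e sim sc b w.
have [s [t [s_inj t_inj gf]]] := nat_adj_gamma_free sim sc.
have [s' [k ek lek] out] := bw_program_ok b w (nest_col_ex s_inj t_inj gf)
  (low_row_ex s_inj t_inj gf) (sorted_adj_gamma s_inj t_inj gf).
by exists k, s'; split=> //; apply: leq_trans lek (pP n).
Qed.
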